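(* Let $(W,S)$ be a Coxeter system, $R$ a fusion ring with basis $\mathfrak B$, $R\Lambda_S$ a geometric $R$-realisation of $(W,S)$, and $(\check W,\mathfrak B\times S)$ the corresponding unfolded Coxeter system. Define $$\check C=\{Z\in\mathrm{Hom}_{\mathbb Z}(R\Lambda_S,\mathbb R)\mid\forall b\in\mathfrak B,\forall s\in S: Z(b\alpha_s)\ge0\},\qquad C=\{Z\in\mathrm{Hom}_R(R\Lambda_S,\mathbb R)\mid\forall s\in S: Z(\alpha_s)\ge0\}.$$ Then the following hold. (i) Both $\check C$ and $C$ are closed convex polyhedral cones, with interiors (in $\mathrm{Hom}_{\mathbb Z}(R\Lambda_S,\mathbb R)$ and $\mathrm{Hom}_R(R\Lambda_S,\mathbb R)$ respectively) $\check C^\circ=\{Z\in\mathrm{Hom}_{\mathbb Z}(R\Lambda_S,\mathbb R)\mid\forall b\in\mathfrak B,\forall s\in S: Z(b\alpha_s)>0\}$ and $C^\circ=\{Z\in\mathrm{Hom}_R(R\Lambda_S,\mathbb R)\mid\forall s\in S: Z(\alpha_s)>0\}$. (ii) The walls of $\check C$ are the hyperplanes $\check H_{b\alpha_s}=\{Z\in\mathrm{Hom}_{\mathbb Z}(R\Lambda_S,\mathbb R)\mid Z(b\alpha_s)=0\}$ for $s\in S$, $b\in\mathfrak B$, and the walls of $C$ are the hyperplanes $H_{\alpha_s}=\{Z\in\mathrm{Hom}_R(R\Lambda_S,\mathbb R)\mid Z(\alpha_s)=0\}$ for $s\in S$. (iii) Each $(b,s)\in\mathfrak B\times S\subset\check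 W$ fixes exactly $\check H_{b\alpha_s}$ in $\mathrm{Hom}_{\mathbb Z}(R\Lambda_S,\mathbb R)$, and each $s\in S$ fixes exactly $H_{\alpha_s}$ in $\mathrm{Hom}_R(R\Lambda_S,\mathbb R)$. (iv) For all $w\in\check W$, $w\cdot\check C^\circ\cap\check C^\circ\ne\emptyset$ if and only if $w=\mathrm{id}$; similarly, for all $w\in W$, $w\cdot C^\circ\cap C^\circ\neq\emptyset$ if and only if $w=\mathrm{id}$. In particular, the Vinberg pairs $(\check C^\circ,\mathfrak B\times S)$ and $(C^\circ,S)$ make $(\check W,\mathfrak B\times S)$ and $(W,S)$ into Vinberg systems respectively.
   Context: Coxeter systems: $S$ is a finite set, $(m_{s,t})_{s,t\in S}$ is a symmetric matrix with $m_{s,s}=1$ and $m_{s,t}\in\{2,3,\dots,\infty\}$ for $s\ne t$, and $W=\langle S\mid (st)^{m_{s,t}}=1 \text{ whenever } m_{s,t}<\infty\rangle$. Rings are unital and associative, not necessarily commutative. Fusion ring: a ring $R$, free as a $\mathbb Z$-module on a finite basis $\mathfrak B=\{b_1,\dots,b_n\}$ with $b_1=1$, such that every product $b_jb_k=\sum_i {}_jc_{k,i}b_i$ is non-zero with all ${}_jc_{k,i}\in\mathbb Z_{\ge0}$, together with an involution $b_j\mapsto b_j^*=b_{j^*}$ of $\mathfrak B$ whose $\mathbb Z$-linear extension $*:R\to R$ satisfies $(rs)^*=s^*r^*$, and such that the coefficient of $1$ in $b_jb_k$ is $1$ if $k=j^*$ and $0$ otherwise. $R_{\ge0}$ is the set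 of non-negative integral combinations of $\mathfrak B$. $\mathrm{FPdim}(b_j)$ is the largest non-negative real (Frobenius–Perron) eigenvalue of the matrix $({}_jc_{k,\ell})_{k,\ell}$; extended $\mathbb Z$-linearly, $\mathrm{FPdim}:R\to\mathbb R$ is a ring homomorphism, with $\mathrm{FPdim}(b)\ge1$ for $b\in\mathfrak B$ and $\mathrm{FPdim}(r^* )=\mathrm{FPdim}(r)$. Geometric $R$-realisation: $R\Lambda_S=\bigoplus_{s\in S}R\alpha_s$ is the free left $R$-module, with a $\mathbb Z$-bilinear form $B_R:R\Lambda_S\times R\Lambda_S\to R$ such that $B_R(x\alpha_s,y\alpha_t)=y\,r_{s,t}\,x^*$ where $r_{s,t}=B_R(\alpha_s,\alpha_t)$ and $r_{s,s}=2$, such that $s(v)=v-B_R(\alpha_s,v)\alpha_s$ ($s\in S$) induces a well-defined left $R$-linear action of $W$ on $R\Lambda_S$; and, for $s\ne t$: $-r_{s,t}\in R_{\ge0}$, $r_{t,s}=r_{s,t}^*$, $\mathrm{FPdim}(r_{s,t})=-2\cos(\pi/m_{s,t})$ if $m_{s,t}<\infty$, and $\mathrm{FPdim}(r_{s,t})\le-2$ if $m_{s,t}=\infty$. Unfolded Coxeter system $(\check W,\check S)$: $\check S=\mathfrak B\times S$. For $(b_i,s),(b_j,t)\in\check S$ define integers $\check r_{(b_i,s),(b_j,t)}$ by: $2$ if $(b_i,s)=(b_j,t)$, $0$ if $s=t$ and $i\ne j$, and for $s\neq t$ by $b_j r_{s,t}=\sum_i \check r_{(b_i,s),(b_j,t)}b_i$.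 Distinct vertices are joined by an edge of the Coxeter graph iff $\check r\ne0$; the label is $3$ if $\check r=-1$ and $\infty$ if $\check r\le-2$ (no edge means $m=2$). $\mathbb Z\Lambda_{\check S}=\bigoplus_{(b,s)}\mathbb Z\alpha_{b,s}$ carries the symmetric form $B_{\mathbb Z}$ with matrix $\check r$, and $\check W$ acts by $(b,s)(v)=v-B_{\mathbb Z}(\alpha_{b,s},v)\alpha_{b,s}$. $\mathbb Z\Lambda_{\check S}$ is identified with $R\Lambda_S$ via $\alpha_{b,s}\leftrightarrow b\alpha_s$, so $\check W$ acts on $R\Lambda_S$ $\mathbb Z$-linearly. $\mathbb R$ is a left $R$-module via $\mathrm{FPdim}$. $W$ acts on $\mathrm{Hom}_R(R\Lambda_S,\mathbb R)$ and $\check W$ acts on $\mathrm{Hom}_{\mathbb Z}(R\Lambda_S,\mathbb R)$ by $(w\cdot Z)(v)=Z(w^{-1}v)$. Vinberg system: for a finite-dimensional real vector space $V$, a closed polyhedral cone $C\subset V$ with non-empty interior $C^\circ$, walls $H_1,\dots,H_n$ (hyperplanes supporting the codimension-one faces), linear reflections $s_i$ of $V$ with fixed hyperplane exactly $H_i$, $S=\{s_1,\dots,s_n\}$ and $W=\langle S\rangle\subseteq GL(V)$: if $w\cdot C^\circ\cap C^\circ\ne\emptyset\iff w=\mathrm{id}$ for all $w\in W$, then $(C^\circ,S)$ is a Vinberg pair, $C^\circ$ the fundamental chamber, and $(W,S)$ a Vinberg system. *)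

(* Defs.v *)
From HB Require Import structures.
From mathcomp Require Import all_boot all_order all_algebra generic_quotient.
From mathcomp Require Import all_classical all_reals all_analysis.
From mathcomp Require Import ring.

Set Implicit Arguments.
Unset Strict Implicit.
Unset Printing Implicit Defensive.

Import Order.TTheory GRing.Theory Num.Theory.
Import numFieldNormedType.Exports.
Import VectorInternalTheory.

Local Open Scope classical_set_scope.
Local Open Scope ring_scope.
Local Open Scope quotient_scope.

(* [None] stands for the label infinity. *)
Record coxeter_matrix (S : finType) := CoxeterMatrix {
  cm :> S -> S -> option nat;
  cm_sym : forall s t, cm s t = cm t s;
  cm_diag : forall s, cm s s = Some 1%N;
  cm_off : forall s t, s != t -> if cm s t is Some n then (2 <= n)%N else true
}.

(* The congruence on words generated by (st)^m(s,t) ~ 1. Since m(s,s) = 1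
   makes every letter its own inverse, the monoid presented in this way is the
   group with the same presentation. *)
Inductive cox_eq (S : finType) (m : coxeter_matrix S) : seq S -> seq S -> Prop :=
| cox_eq_refl u : cox_eq m u u
| cox_eq_sym u v : cox_eq m u v -> cox_eq m v u
| cox_eq_trans u v w : cox_eq m u v -> cox_eq m v w -> cox_eq m u w
| cox_eq_rel u v s t n : m s t = Some n ->
    cox_eq m (u ++ flatten (nseq n [:: s; t]) ++ v) (u ++ v).

Section CoxeterGroup.
Variables (S : finType) (m : coxeter_matrix S).

Definition cox_eqb (u v : seq S) : bool := `[< cox_eq m u v >].

Lemma cox_eqb_refl : reflexive cox_eqb.
Proof. by move=> u; apply/asboolP; exact: cox_eq_refl. Qed.

Lemma cox_eqb_sym : symmetric cox_eqb.
Proof. by move=> u v; apply/asboolP/asboolP; exact: cox_eq_sym. Qed.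

Lemma cox_eqb_trans : transitive cox_eqb.
Proof.
by move=> v u w /asboolP uv /asboolP vw; apply/asboolP; exact: cox_eq_trans vw.
Qed.

Canonical cox_equiv := EquivRel cox_eqb cox_eqb_refl cox_eqb_sym cox_eqb_trans.

Definition coxeter_group : Type := {eq_quot cox_equiv}.
HB.instance Definition _ := Choice.on coxeter_group.

Definition cox_word (u : seq S) : coxeter_group := \pi_({eq_quot cox_equiv}) u.
Definition cox_repr (w : coxeter_group) : seq S :=
  repr (w : {eq_quot cox_equiv}).

Lemma cox_wordP u v : cox_word u = cox_word v <-> cox_eq m u v.
Proof. by split=> [/eqmodP/asboolP|uv]; last apply/eqmodP/asboolP. Qed.

Lemma cox_reprK : cancel cox_repr cox_word.
Proof. exact: reprK. Qed.

Lemma cox_eq_cat u u' v v' :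
  cox_eq m u u' -> cox_eq m v v' -> cox_eq m (u ++ v) (u' ++ v').
Proof.
move=> uu' vv'; apply: (@cox_eq_trans _ _ _ (u' ++ v)).
- elim: uu' => [*|? ? _ ?|? ? ? _ h _ ?|a b s t n mst].
  + exact: cox_eq_refl.
  + exact: cox_eq_sym.
  + exact: cox_eq_trans h _.
  + by rewrite -!catA; exact: cox_eq_rel.
- elim: vv' => [*|? ? _ ?|? ? ? _ h _ ?|a b s t n mst].
  + exact: cox_eq_refl.
  + exact: cox_eq_sym.
  + exact: cox_eq_trans h _.
  + by rewrite !catA -(catA _ _ b); exact: cox_eq_rel.
Qed.

Lemma cox_eq_ss s : cox_eq m [:: s; s] [::].
Proof. exact: (cox_eq_rel [::] [::] (cm_diag m s)). Qed.

Lemma cox_eq_rev u v : cox_eq m u v -> cox_eq m (rev u) (rev v).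
Proof.
elim=> {u v} [*|? ? _ ?|? ? ? _ h _ ?|u v s t n mst].
- exact: cox_eq_refl.
- exact: cox_eq_sym.
- exact: cox_eq_trans h _.
- rewrite !rev_cat -catA.
  suff -> : rev (flatten (nseq n [:: s; t])) = flatten (nseq n [:: t; s]).
    by apply: cox_eq_rel; rewrite cm_sym.
  elim: n {mst} => //= n IHn.
  have sw k : flatten (nseq k [:: t; s]) ++ [:: t; s]
            = [:: t, s & flatten (nseq k [:: t; s])].
    by elim: k => //= k ->.
  by rewrite !rev_cons -!cats1 -catA IHn /= sw.
Qed.

Lemma cox_eq_revl u : cox_eq m (rev u ++ u) [::].
Proof.
elim: u => [|s u IHu]; first exact: cox_eq_refl.
rewrite rev_cons -cats1 -catA; apply: cox_eq_trans IHu.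
by apply: cox_eq_cat (cox_eq_refl _ _) _;
  exact: (cox_eq_rel [::] u (cm_diag m s)).
Qed.

Definition cox_one : coxeter_group := cox_word [::].
Definition cox_mul (x y : coxeter_group) : coxeter_group :=
  cox_word (cox_repr x ++ cox_repr y).
Definition cox_inv (x : coxeter_group) : coxeter_group :=
  cox_word (rev (cox_repr x)).

Lemma cox_repr_word u : cox_eq m (cox_repr (cox_word u)) u.
Proof. by apply/cox_wordP; rewrite cox_reprK. Qed.

Lemma cox_mul_word u v : cox_mul (cox_word u) (cox_word v) = cox_word (u ++ v).
Proof. by apply/cox_wordP; apply: cox_eq_cat; exact: cox_repr_word. Qed.

Lemma cox_inv_word u : cox_inv (cox_word u) = cox_word (rev u).
Proof. by apply/cox_wordP; apply: cox_eq_rev; exact: cox_repr_word. Qed.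

Lemma cox_mulA : associative cox_mul.
Proof.
move=> x y z; rewrite -[x]cox_reprK -[y]cox_reprK -[z]cox_reprK.
by rewrite !cox_mul_word catA.
Qed.

Lemma cox_mul1 : left_id cox_one cox_mul.
Proof. by move=> x; rewrite -[x]cox_reprK cox_mul_word. Qed.

Lemma cox_mulr1 : right_id cox_one cox_mul.
Proof. by move=> x; rewrite -[x]cox_reprK cox_mul_word cats0. Qed.

Lemma cox_mulV : left_inverse cox_one cox_inv cox_mul.
Proof.
move=> x; rewrite -[x]cox_reprK cox_inv_word cox_mul_word.
by apply/cox_wordP; exact: cox_eq_revl.
Qed.

Lemma cox_mulrV : right_inverse cox_one cox_inv cox_mul.
Proof.
move=> x; rewrite -[x]cox_reprK cox_inv_word cox_mul_word.
by apply/cox_wordP; rewrite -{1}[cox_repr x]revK; exact: cox_eq_revl.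
Qed.

HB.instance Definition _ := isGroup.Build coxeter_group
  cox_mulA cox_mul1 cox_mulr1 cox_mulV cox_mulrV.

Definition cox_gen (s : S) : coxeter_group := cox_word [:: s].

(* The action of the group induced by maps [f s] satisfying the Coxeter
   relations; under this assumption [cox_act_word] shows that the choice of a
   representative word is irrelevant. *)
Definition cox_act (X : Type) (f : S -> X -> X) (w : coxeter_group) (x : X) : X :=
  foldr f x (cox_repr w).

Section Action.
Variables (X : Type) (f : S -> X -> X).
Hypothesis frel : forall s t n, m s t = Some n ->
  forall x, iter n (f s \o f t) x = x.

Lemma cox_act_word u x : cox_act f (cox_word u) x = foldr f x u.
Proof.
suff H a b : cox_eq m a b -> forall x, foldr f x a = foldr f x b.
  exact: (H _ _ (cox_repr_word u)).
elim=> {a b} [|? ? _ h y|? ? ? _ h _ h' y|a b s t n mst y] //.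
  by rewrite h h'.
rewrite !foldr_cat; congr foldr.
rewrite -[RHS](frel mst); elim: n {mst} => //= n ->.
by [].
Qed.

Lemma cox_act_gen s x : cox_act f (cox_gen s) x = f s x.
Proof. exact: cox_act_word. Qed.

Lemma cox_act1 x : cox_act f 1%g x = x.
Proof. exact: cox_act_word. Qed.

Lemma cox_actM w w' x : cox_act f (w * w')%g x = cox_act f w (cox_act f w' x).
Proof. by rewrite [LHS]cox_act_word foldr_cat. Qed.

End Action.

End CoxeterGroup.

(* [B] indexes the basis; [fr_coord F x i] is the coefficient of x on the basis
   element F i, so that [fr_coord F (F j * F k) i] is the structure constant. *)
Record fusion_ring (R : nzRingType) (B : finType) := FusionRing {
  fr_basis :> B -> R;
  fr_one : B;
  fr_star : B -> B;
  fr_coord : R -> B -> int;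
  fr_basis1 : fr_basis fr_one = 1;
  fr_expand : forall x, x = \sum_i fr_basis i *~ fr_coord x i;
  fr_free : forall (c : B -> int) j,
    fr_coord (\sum_i fr_basis i *~ c i) j = c j;
  fr_mul_neq0 : forall j k, fr_basis j * fr_basis k != 0;
  fr_coord_ge0 : forall j k i, 0 <= fr_coord (fr_basis j * fr_basis k) i;
  fr_starK : involutive fr_star;
  fr_starM : let star x := \sum_i fr_basis (fr_star i) *~ fr_coord x i in
    forall x y, star (x * y) = star y * star x;
  fr_coord_one : forall j k,
    fr_coord (fr_basis j * fr_basis k) fr_one = (k == fr_star j)%:R
}.

Section FusionRing.
Variables (R : nzRingType) (B : finType) (F : fusion_ring R B).

Definition starR (x : R) : R := \sum_i F (fr_star F i) *~ fr_coord F x i.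

Definition fr_nneg (x : R) : Prop := forall i, 0 <= fr_coord F x i.

Definition fusion_mx (K : realType) (j : B) : 'M[K]_#|B| :=
  \matrix_(k, l) (fr_coord F (F j * F (enum_val k)) (enum_val l))%:~R.

(* The set is finite, and non-empty by Perron-Frobenius: the supremum is its
   largest element. *)
Definition FPdim_basis (K : realType) (j : B) : K :=
  sup [set a : K | 0 <= a /\ eigenvalue (fusion_mx K j) a].

Definition FPdim (K : realType) (x : R) : K :=
  \sum_i (fr_coord F x i)%:~R * FPdim_basis K i.

Lemma fr_coordD x y i : fr_coord F (x + y) i = fr_coord F x i + fr_coord F y i.
Proof.
rewrite {1}(fr_expand F x) {1}(fr_expand F y) -big_split /=.
under eq_bigr => j _ do rewrite -mulrzDr.
exact: fr_free.
Qed.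

Lemma fr_coord0 i : fr_coord F 0 i = 0.
Proof. by apply: (addrI (fr_coord F 0 i)); rewrite -fr_coordD !addr0. Qed.

Lemma fr_coordN x i : fr_coord F (- x) i = - fr_coord F x i.
Proof. by apply/eqP; rewrite -addr_eq0 -fr_coordD addNr fr_coord0. Qed.

Lemma fr_coord_basis j i : fr_coord F (F j) i = (i == j)%:R.
Proof.
rewrite -[RHS](fr_free F (fun i => (i == j)%:R)); congr (fr_coord F _ _).
rewrite (bigD1 j) //= eqxx big1 ?addr0 // => k /negPf ->.
exact: mulr0z.
Qed.

Lemma starRD x y : starR (x + y) = starR x + starR y.
Proof.
rewrite /starR -big_split /=; apply: eq_bigr => i _.
by rewrite fr_coordD mulrzDr.
Qed.

Lemma fr_coord_star x i : fr_coord F (starR x) i = fr_coord F x (fr_star F i).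
Proof.
rewrite /starR (reindex_inj (inv_inj (fr_starK F))) /=.
by under eq_bigr => j _ do rewrite fr_starK; rewrite fr_free.
Qed.

Lemma starRK x : starR (starR x) = x.
Proof.
rewrite {1}/starR [RHS](fr_expand F x) (reindex_inj (inv_inj (fr_starK F))) /=.
by apply: eq_bigr => i _; rewrite fr_coord_star !fr_starK.
Qed.

Lemma starR_basis j : starR (F j) = F (fr_star F j).
Proof.
rewrite /starR (bigD1 j) //= fr_coord_basis eqxx big1 ?addr0 // => i /negPf nij.
by rewrite fr_coord_basis nij mulr0z.
Qed.

Lemma starRM x y : starR (x * y) = starR y * starR x.
Proof. exact: (fr_starM F). Qed.

Lemma fr_star_one : fr_star F (fr_one F) = fr_one F.
Proof.
have := fr_coord_one F (fr_one F) (fr_one F).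
by rewrite fr_basis1 mul1r -(fr_basis1 F) fr_coord_basis eqxx;
  case: eqP => // ->.
Qed.

Lemma fr_trace_basis j x :
  fr_coord F (F (fr_star F j) * x) (fr_one F) = fr_coord F x j.
Proof.
pose h y := fr_coord F (F (fr_star F j) * y) (fr_one F).
have h0 : h 0 = 0 by rewrite /h mulr0 fr_coord0.
have hD y z : h (y + z) = h y + h z by rewrite /h mulrDr fr_coordD.
have hN y : h (- y) = - h y by rewrite /h mulrN fr_coordN.
have hZ y (n : int) : h (y *~ n) = h y * n.
  have hn (k : nat) : h (y *+ k) = h y * k%:Z.
    by elim: k => [|k IHk]; rewrite ?mulr0n ?mulr0 // mulrSr hD IHk intS; ring.
  case: n => k; first by rewrite -pmulrn hn.
  by rewrite NegzE mulrNz -pmulrn hN hn mulrN.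
rewrite -/(h x) {1}(fr_expand F x) (big_morph h hD h0).
rewrite (bigD1 j) //= big1 ?addr0 => [|i nij]; rewrite hZ /h fr_coord_one fr_starK.
  by rewrite eqxx mul1r.
by rewrite (negPf nij) mul0r.
Qed.

Lemma fr_tracel j x :
  fr_coord F (F j * x) (fr_one F) = fr_coord F x (fr_star F j).
Proof. by rewrite -[in LHS](fr_starK F j) fr_trace_basis. Qed.

Lemma fr_tracer j x :
  fr_coord F (x * F j) (fr_one F) = fr_coord F x (fr_star F j).
Proof.
rewrite -fr_star_one -fr_coord_star starRM starR_basis fr_trace_basis.
exact: fr_coord_star.
Qed.

End FusionRing.

(* [R^o] carries left multiplication, so this is the free left module. *)
Definition RLambda (R : nzRingType) (S : finType) : lmodType R := {ffun S -> R^o}.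

Definition alpha {R : nzRingType} {S : finType} (s : S) : RLambda R S :=
  [ffun t => (t == s)%:R].

Definition ZLambda (B S : finType) : zmodType := {ffun B * S -> int}.

Definition unf_alpha {B S : finType} (x : B * S) : ZLambda B S :=
  [ffun y => (y == x)%:R].

(* The identification of the basis element of index (b, s) with b alpha_s. *)
Section Identification.
Variables (S : finType) (R : nzRingType) (B : finType) (F : fusion_ring R B).

Definition fold_Lambda (v : ZLambda B S) : RLambda R S :=
  \sum_x (F x.1 *: alpha x.2) *~ v x.

Definition unfold_Lambda (v : RLambda R S) : ZLambda B S :=
  [ffun x => fr_coord F (v x.2) x.1].

Lemma fold_LambdaD : {morph fold_Lambda : u v / u + v}.
Proof.
move=> u v; rewrite /fold_Lambda -big_split; apply: eq_bigr => x _.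
by rewrite ffunE mulrzDr.
Qed.

Lemma unfold_LambdaD : {morph unfold_Lambda : u v / u + v}.
Proof. by move=> u v; apply/ffunP => x; rewrite !ffunE fr_coordD. Qed.

Lemma fold_LambdaE v s : fold_Lambda v s = \sum_b F b *~ v (b, s).
Proof.
rewrite /fold_Lambda sum_ffunE.
pose h b t := ((F b *: alpha t) *~ v (b, t) : RLambda R S) s.
transitivity (\sum_p h p.1 p.2); first by apply: eq_bigr => -[b t] _.
rewrite -(pair_bigA _ h) /h /=.
apply: eq_bigr => b _; rewrite (bigD1 s) //= big1 ?addr0 => [|t /negPf nts].
  by rewrite ffunMzE !ffunE eqxx; congr (_ *~ _); exact: mulr1.
rewrite ffunMzE !ffunE eq_sym nts (_ : _ *: _ = 0) ?mul0rz //; exact: mulr0.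
Qed.

Lemma fold_LambdaK : cancel fold_Lambda unfold_Lambda.
Proof.
move=> v; apply/ffunP => -[b s]; rewrite ffunE fold_LambdaE /=.
exact: fr_free.
Qed.

Lemma unfold_LambdaK : cancel unfold_Lambda fold_Lambda.
Proof.
move=> v; apply/ffunP => s; rewrite fold_LambdaE [RHS](fr_expand F).
by apply: eq_bigr => b _; rewrite ffunE.
Qed.

Lemma Lambda_ext (V : zmodType) (f g : RLambda R S -> V) :
  {morph f : u v / u + v} -> {morph g : u v / u + v} ->
  (forall b s, f (F b *: alpha s) = g (F b *: alpha s)) -> f =1 g.
Proof.
move=> fD gD fg v; rewrite -(unfold_LambdaK v) /fold_Lambda.
have f0 : f 0 = 0 by apply: (addrI (f 0)); rewrite -fD !addr0.
have g0 : g 0 = 0 by apply: (addrI (g 0)); rewrite -gD !addr0.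
have fN u : f (- u) = - f u by apply/eqP; rewrite -addr_eq0 -fD addNr f0.
have gN u : g (- u) = - g u by apply/eqP; rewrite -addr_eq0 -gD addNr g0.
have fn u k : f u = g u -> f (u *+ k) = g (u *+ k).
  by move=> e; elim: k => [|k IHk]; rewrite ?mulr0n ?f0 ?g0 // !mulrS fD gD e IHk.
have fZ u n : f u = g u -> f (u *~ n) = g (u *~ n).
  case: n => k e; first by rewrite -!pmulrn fn.
  by rewrite !NegzE !mulrNz -!pmulrn fN gN fn.
rewrite (big_morph f fD f0) (big_morph g gD g0).
by apply: eq_bigr => x _; exact: fZ.
Qed.

End Identification.

Record geometric_realisation (K : realType) (S : finType) (m : coxeter_matrix S)
    (R : nzRingType) (B : finType) (F : fusion_ring R B) := GeometricRealisation {
  gr_form : RLambda R S -> RLambda R S -> R;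
  gr_act : coxeter_group m -> RLambda R S -> RLambda R S;
  gr_formDl : forall v, {morph gr_form^~ v : u u' / u + u'};
  gr_formDr : forall u, {morph gr_form u : v v' / v + v'};
  gr_formZ : forall x y s t, gr_form (x *: alpha s) (y *: alpha t) =
    y * gr_form (alpha s) (alpha t) * starR F x;
  gr_form_diag : forall s, gr_form (alpha s) (alpha s) = 2%:R;
  gr_act_linear : forall w, linear (gr_act w);
  gr_act1 : gr_act 1%g =1 id;
  gr_actM : forall w w' v, gr_act (w * w')%g v = gr_act w (gr_act w' v);
  gr_act_gen : forall s v,
    gr_act (cox_gen m s) v = v - gr_form (alpha s) v *: alpha s;
  gr_form_nneg : forall s t, s != t ->
    fr_nneg F (- gr_form (alpha s) (alpha t));
  gr_form_star : forall s t, s != t ->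
    gr_form (alpha t) (alpha s) = starR F (gr_form (alpha s) (alpha t));
  gr_form_fin : forall s t n, s != t -> m s t = Some n ->
    FPdim F K (gr_form (alpha s) (alpha t)) = - (2 * cos (pi / n%:R));
  gr_form_inf : forall s t, s != t -> m s t = None ->
    FPdim F K (gr_form (alpha s) (alpha t)) <= - 2
}.

Section Unfolding.
Variables (K : realType) (S : finType) (m : coxeter_matrix S).
Variables (R : nzRingType) (B : finType) (F : fusion_ring R B).
Variable G : geometric_realisation K m F.

Definition unf_r (x y : B * S) : int :=
  if x == y then 2
  else if x.2 == y.2 then 0
  else fr_coord F (F y.1 * gr_form G (alpha x.2) (alpha y.2)) x.1.

Lemma unf_r_sym x y : unf_r x y = unf_r y x.
Proof.
rewrite /unf_r eq_sym (eq_sym x.2).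
case: eqP => // _; case: eqP => // /eqP; rewrite eq_sym => xy.
rewrite (gr_form_star G xy); set r := gr_form G _ _.
rewrite -[in LHS](fr_starK F x.1) -fr_tracer -mulrA fr_tracel.
by rewrite -fr_coord_star starRM starR_basis fr_starK.
Qed.

(* For x <> y, [unf_r x y] is at most 0, so that [None] is the label for values
   at most -2. *)
Definition unf_label (x y : B * S) : option nat :=
  if x == y then Some 1%N
  else if unf_r x y == 0 then Some 2%N
  else if unf_r x y == -1 then Some 3%N
  else None.

Lemma unf_label_sym x y : unf_label x y = unf_label y x.
Proof. by rewrite /unf_label eq_sym unf_r_sym. Qed.

Lemma unf_label_diag x : unf_label x x = Some 1%N.
Proof. by rewrite /unf_label eqxx. Qed.

Lemma unf_label_off x y :
  x != y -> if unf_label x y is Some n then (2 <= n)%N else true.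
Proof. by rewrite /unf_label => /negPf ->; do 2![case: ifP => // _]. Qed.

Definition unf_matrix : coxeter_matrix (B * S)%type :=
  CoxeterMatrix unf_label_sym unf_label_diag unf_label_off.

Definition unf_group := coxeter_group unf_matrix.

Definition unf_form (u v : ZLambda B S) : int :=
  \sum_x \sum_y u x * unf_r x y * v y.

Definition unf_refl (x : B * S) (v : ZLambda B S) : ZLambda B S :=
  v - unf_alpha x *~ unf_form (unf_alpha x) v.

Lemma unf_form_alpha x v : unf_form (unf_alpha x) v = \sum_y unf_r x y * v y.
Proof.
rewrite /unf_form (bigD1 x) //= [X in _ + X]big1 ?addr0 => [|z /negPf nzx].
  by apply: eq_bigr => y _; rewrite ffunE eqxx mul1r.
by apply: big1 => y _; rewrite ffunE nzx !mul0r.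
Qed.

Lemma unf_form_alphaD x v w : unf_form (unf_alpha x) (v + w) =
  unf_form (unf_alpha x) v + unf_form (unf_alpha x) w.
Proof.
rewrite !unf_form_alpha -big_split; apply: eq_bigr => y _.
by rewrite ffunE mulrDr.
Qed.

Lemma unf_form_alphaZ x y n :
  unf_form (unf_alpha x) (unf_alpha y *~ n) = unf_r x y * n.
Proof.
rewrite unf_form_alpha (bigD1 y) //= big1 ?addr0 => [|z /negPf nzy];
  by rewrite ffunMzE ffunE ?eqxx ?nzy ?mul0rz ?mulr0 // intz.
Qed.

Lemma unf_reflD x v w : unf_refl x (v + w) = unf_refl x v + unf_refl x w.
Proof. by rewrite /unf_refl unf_form_alphaD mulrzDr opprD addrACA. Qed.

Lemma unf_refl_rel x y n : unf_matrix x y = Some n ->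
  forall v, iter n (unf_refl x \o unf_refl y) v = v.
Proof.
move=> mxy v; have rxx z : unf_r z z = 2 by rewrite /unf_r eqxx.
set p := unf_form (unf_alpha x) v; set q := unf_form (unf_alpha y) v.
pose c (a b : int) := v + unf_alpha x *~ a + unf_alpha y *~ b.
have rx a b : unf_refl x (c a b) = c (- a - p - unf_r x y * b) b.
  rewrite /unf_refl !unf_form_alphaD !unf_form_alphaZ rxx -/p /c.
  rewrite addrAC -[X in X + _ = _]addrA -mulrzBr; congr (_ + _ *~ _ + _); ring.
have ry a b : unf_refl y (c a b) = c a (- b - q - unf_r x y * a).
  rewrite /unf_refl !unf_form_alphaD !unf_form_alphaZ rxx -/q /c.
  rewrite (unf_r_sym y x) -[LHS]addrA -mulrzBr; congr (_ + _ *~ _); ring.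
have c0 : c 0 0 = v by rewrite /c !mulr0z !addr0.
rewrite -[in LHS]c0; move: mxy; rewrite /= /unf_label.
case: (eqVneq x y) => [xy [<-] /=|_].
  rewrite ry -xy rx /c -xy rxx -/p -addrA -mulrzDr -[RHS]addr0; congr (_ + _).
  have -> : q = p by rewrite /q -xy.
  rewrite (_ : _ + _ = 0) ?mulr0z //; ring.
case: eqP => [r0 [<-] /=|_].
  rewrite !(rx, ry) r0 -[RHS]c0; congr (c _ _); ring.
case: eqP => [r1 [<-] /=|//].
rewrite !(rx, ry) r1 -[RHS]c0; congr (c _ _); ring.
Qed.

Definition ZLambda_act (w : unf_group) : ZLambda B S -> ZLambda B S := cox_act unf_refl w.

Lemma ZLambda_act_gen x v : ZLambda_act (cox_gen unf_matrix x) v = unf_refl x v.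
Proof. exact: cox_act_gen unf_refl_rel x v. Qed.

Lemma ZLambda_act1 v : ZLambda_act 1%g v = v.
Proof. exact: cox_act1 unf_refl_rel v. Qed.

Lemma ZLambda_actM w w' v :
  ZLambda_act (w * w')%g v = ZLambda_act w (ZLambda_act w' v).
Proof. exact: cox_actM unf_refl_rel w w' v. Qed.

Lemma ZLambda_actD w u v :
  ZLambda_act w (u + v) = ZLambda_act w u + ZLambda_act w v.
Proof.
rewrite /ZLambda_act /cox_act; elim: (cox_repr w) => //= x s ->.
exact: unf_reflD.
Qed.

Definition unf_act (w : unf_group) (v : RLambda R S) : RLambda R S :=
  fold_Lambda F (ZLambda_act w (unfold_Lambda F v)).

Lemma unf_act1 v : unf_act 1%g v = v.
Proof. by rewrite /unf_act ZLambda_act1 unfold_LambdaK. Qed.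

Lemma unf_actM w w' v : unf_act (w * w')%g v = unf_act w (unf_act w' v).
Proof. by rewrite /unf_act ZLambda_actM fold_LambdaK. Qed.

Lemma unf_actD w : {morph unf_act w : u v / u + v}.
Proof.
by move=> u v; rewrite /unf_act unfold_LambdaD ZLambda_actD fold_LambdaD.
Qed.

End Unfolding.

Lemma Vector_axiom_inj (K : fieldType) (U : lmodType K) n (f : U -> 'rV[K]_n) :
  linear f -> injective f -> {d & Vector.axiom d U}.
Proof.
move=> flin finj.
have f0 : f 0 = 0 by have := flin (-1) 0 0; rewrite !scaleN1r !addNr.
have fZ a u : f (a *: u) = a *: f u by have := flin a u 0; rewrite f0 !addr0.
have fD u v : f (u + v) = f u + f v by have := flin 1 u v; rewrite !scale1r.
pose P (d : nat) := `[< exists X : {vspace 'rV[K]_n},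
  (forall v, v \in X -> exists u, f u = v) /\ \dim X = d >].
have P0 : exists d, P d.
  exists 0%N; apply/asboolP; exists 0%VS; split; last exact: dimv0.
  by move=> v; rewrite memv0 => /eqP ->; exists 0.
have Pn d : P d -> (d <= n)%N.
  move=> /asboolP[X [_ <-]].
  by rewrite (leq_trans (dimvS (subvf X))) // dimvf /dim /= mul1n.
case: (ex_maxnP P0 Pn) => d /asboolP Pd dmax.
case: (cid Pd) => X [XP dX]; exists (\dim X).
have fX u : f u \in X.
  apply: contrapT => /negP fuX.
  have lt : (d < \dim (X + <[f u]>)%VS)%N.
    rewrite -dX ltnNge; apply/negP => le.
    have /eqP XE : X == (X + <[f u]>)%VS by rewrite eqEdim addvSl.
    by move: fuX; rewrite XE (subvP (addvSr _ _)) ?memv_line.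
  suff /dmax : P (\dim (X + <[f u]>)%VS) by rewrite leqNgt lt.
  apply/asboolP; exists (X + <[f u]>)%VS; split => // v /memv_addP[x xX [y yu ->]].
  have /vlineP[a ->] := yu; have [w <-] := XP _ xX.
  by exists (w + a *: u); rewrite fD fZ.
pose g u : 'rV[K]_(\dim X) := \row_i coord (vbasis X) i (f u).
have fg u : f u = \sum_i g u 0 i *: (vbasis X)`_i.
  rewrite [LHS](coord_vbasis (fX u)); apply: eq_bigr => i _.
  by rewrite mxE.
exists g; first by move=> a u v; apply/rowP => i; rewrite !mxE flin linearP.
have ginj : injective g by move=> u v guv; apply: finj; rewrite !fg guv.
have gsurj y : exists u, g u = y.
  have [|u fu] := XP (\sum_i y 0 i *: (vbasis X)`_i).
    by apply: memv_suml => i _; rewrite memvZ // vbasis_mem // mem_nth ?size_tuple.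
  exists u; apply/rowP => i; rewrite mxE fu.
  by rewrite coord_sum_free // (basis_free (vbasisP X)).
pose g' y := sval (cid (gsurj y)).
have g'K y : g (g' y) = y by rewrite /g'; case: cid.
by exists g' => // u; apply: ginj; rewrite g'K.
Qed.

Section Hom.
Variables (K : realType) (S : finType).
Variables (R : nzRingType) (B : finType) (F : fusion_ring R B).

Definition is_HomZ : {pred RLambda R S -> K^o} :=
  fun Z => `[< {morph Z : u v / u + v} >].

(* The action of [R] on the real numbers is through [FPdim]. *)
Definition is_HomR : {pred RLambda R S -> K^o} :=
  fun Z => `[< {morph Z : u v / u + v} /\
               forall x v, Z (x *: v) = FPdim F K x * Z v >].

End Hom.

(* [F] is a parameter of [HomZ] because its finite dimension comes from [F]. *)
Record HomZ (K : realType) (S : finType) (R : nzRingType) (B : finType)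
    (F : fusion_ring R B) := MkHomZ {
  HomZ_fun :> RLambda R S -> K^o;
  HomZP : is_HomZ HomZ_fun }.

Record HomR (K : realType) (S : finType) (R : nzRingType) (B : finType)
    (F : fusion_ring R B) := MkHomR {
  HomR_fun :> RLambda R S -> K^o;
  HomRP : is_HomR F HomR_fun }.

Section HomVect.
Variables (K : realType) (S : finType).
Variables (R : nzRingType) (B : finType) (F : fusion_ring R B).
Local Notation HomZ := (HomZ K S F).
Local Notation HomR := (HomR K S F).
Local Notation is_HomZ := (@is_HomZ K S R).
Local Notation is_HomR := (@is_HomR K S R B F).

Fact HomZ_closed : subsemimod_closed is_HomZ.
Proof.
split=> [|a Z /asboolP ZD]; last first.
  by apply/asboolP => u v; rewrite -[LHS]/(a *: Z (u + v)) ZD scalerDr.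
split=> [|Z Z' /asboolP ZD /asboolP ZD']; apply/asboolP => u v.
  by rewrite -[RHS]/(0 + 0 : K^o) addr0.
by rewrite -[LHS]/(Z (u + v) + Z' (u + v)) ZD ZD' addrACA.
Qed.
HB.instance Definition _ :=
  GRing.isSubmodClosed.Build K (RLambda R S -> K^o) is_HomZ HomZ_closed.

Fact HomR_closed : subsemimod_closed is_HomR.
Proof.
split=> [|a Z /asboolP[ZD ZL]]; last first.
  apply/asboolP; split=> [u v|x v].
    by rewrite -[LHS]/(a *: Z (u + v)) ZD scalerDr.
  by rewrite -[LHS]/(a * Z (x *: v)) ZL mulrCA.
split=> [|Z Z' /asboolP[ZD ZL] /asboolP[ZD' ZL']]; apply/asboolP; split.
- by move=> u v; rewrite -[RHS]/(0 + 0 : K^o) addr0.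
- by move=> x v; rewrite -[RHS]/(FPdim F K x * 0) mulr0.
- by move=> u v; rewrite -[LHS]/(Z (u + v) + Z' (u + v)) ZD ZD' addrACA.
- by move=> x v; rewrite -[LHS]/(Z (x *: v) + Z' (x *: v)) ZL ZL' -mulrDr.
Qed.
HB.instance Definition _ :=
  GRing.isSubmodClosed.Build K (RLambda R S -> K^o) is_HomR HomR_closed.

HB.instance Definition _ := [isSub of HomZ for @HomZ_fun K S R B F].
HB.instance Definition _ := [Choice of HomZ by <:].
HB.instance Definition _ := [SubChoice_isSubLmodule of HomZ by <:].

HB.instance Definition _ := [isSub of HomR for @HomR_fun K S R B F].
HB.instance Definition _ := [Choice of HomR by <:].
HB.instance Definition _ := [SubChoice_isSubLmodule of HomR by <:].

Lemma HomZ_add (Z : HomZ) : {morph Z : u v / u + v}.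
Proof. exact/asboolP/HomZP. Qed.

Lemma HomR_add (Z : HomR) : {morph Z : u v / u + v}.
Proof. by have /asboolP[] := HomRP Z. Qed.

Lemma HomR_scale (Z : HomR) x v : Z (x *: v) = FPdim F K x * Z v.
Proof. by have /asboolP[] := HomRP Z. Qed.

Definition hom_coords (Z : RLambda R S -> K^o) : 'rV[K]_#|{: B * S}| :=
  \row_i Z (F (enum_val i).1 *: alpha (enum_val i).2).

Lemma hom_coords_inj (Z Z' : RLambda R S -> K^o) :
  {morph Z : u v / u + v} -> {morph Z' : u v / u + v} ->
  hom_coords Z = hom_coords Z' -> Z = Z'.
Proof.
move=> ZD ZD' /rowP ZZ'; apply/funext; apply: (Lambda_ext (F := F) ZD ZD') => b s.
by have := ZZ' (enum_rank (b, s)); rewrite !mxE enum_rankK.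
Qed.

Lemma HomZ_vect : {d & Vector.axiom d HomZ}.
Proof.
apply: (@Vector_axiom_inj _ HomZ _ (fun Z : HomZ => hom_coords Z)).
  by move=> a Z Z'; apply/rowP => i; rewrite !mxE.
move=> Z Z' ZZ'; apply/val_inj; apply: hom_coords_inj ZZ'; exact: HomZ_add.
Qed.
HB.instance Definition _ :=
  Lmodule_hasFinDim.Build K HomZ (projT2 HomZ_vect).

Lemma HomR_vect : {d & Vector.axiom d HomR}.
Proof.
apply: (@Vector_axiom_inj _ HomR _ (fun Z : HomR => hom_coords Z)).
  by move=> a Z Z'; apply/rowP => i; rewrite !mxE.
move=> Z Z' ZZ'; apply/val_inj; apply: hom_coords_inj ZZ'; exact: HomR_add.
Qed.
HB.instance Definition _ :=
  Lmodule_hasFinDim.Build K HomR (projT2 HomR_vect).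

End HomVect.

(* (w . Z)(v) = Z(w^-1 v) *)
Section DualActions.
Variables (K : realType) (S : finType) (m : coxeter_matrix S).
Variables (R : nzRingType) (B : finType) (F : fusion_ring R B).
Variable G : geometric_realisation K m F.

Fact HomZ_act_subproof (w : unf_group G) (Z : HomZ K S F) :
  @is_HomZ K S R (fun v => Z (unf_act w^-1%g v)).
Proof. by apply/asboolP => u v; rewrite unf_actD HomZ_add. Qed.

Definition HomZ_act (w : unf_group G) (Z : HomZ K S F) : HomZ K S F :=
  MkHomZ F (HomZ_act_subproof w Z).

Fact HomR_act_subproof (w : coxeter_group m) (Z : HomR K S F) :
  @is_HomR K S R B F (fun v => Z (gr_act G w^-1%g v)).
Proof.
have lin a u v := gr_act_linear G w^-1%g a u v.
have h0 : gr_act G w^-1%g 0 = 0.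
  by have := lin (-1) 0 0; rewrite !scaleN1r !addNr.
apply/asboolP; split=> [u v|x v].
  by have := lin 1 u v; rewrite !scale1r => ->; exact: HomR_add.
by have := lin x v 0; rewrite h0 !addr0 => ->; exact: HomR_scale.
Qed.

Definition HomR_act (w : coxeter_group m) (Z : HomR K S F) : HomR K S F :=
  MkHomR (HomR_act_subproof w Z).

End DualActions.

Section Vinberg.
Variables (K : realType) (V : vectType K).

(* The topology of the finite-dimensional space V is transported from that of
   row vectors along [v2r]; any other basis would give the same topology. *)
Definition vinterior (A : set V) : set V :=
  [set v | (interior [set x : 'rV[K]_(dim V) | A (r2v x)]) (v2r v)].

Definition vclosed (A : set V) : Prop :=
  closed [set x : 'rV[K]_(dim V) | A (r2v x)].

Definition polyhedral_cone (C : set V) : Prop :=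
  exists fs : seq 'Hom(V, K^o), C = [set v | forall f, f \in fs -> 0 <= f v].

Definition closed_convex_polyhedral_cone (C : set V) : Prop :=
  [/\ vclosed C, convex_set C & polyhedral_cone C].

(* [A] spans a subspace of dimension [n]. For a face of a cone, this is its
   dimension. *)
Definition spans_dim (A : set V) (n : nat) : Prop :=
  (exists X : seq V, [/\ {in X, forall x, A x}, free X & size X = n]) /\
  (forall X : seq V, {in X, forall x, A x} -> free X -> (size X <= n)%N).

(* The hyperplane [H] supports [C], and the face [C `&` H] has codimension 1. *)
Definition is_wall (C H : set V) : Prop :=
  (exists f : 'Hom(V, K^o),
    [/\ f != 0, H = [set v | f v = 0] & forall v, C v -> 0 <= f v]) /\
  (exists2 n, n.+1 = \dim {:V} & spans_dim (C `&` H) n).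

Definition fixed_points (f : V -> V) : set V := [set v | f v = v].

Definition linear_reflection (f : V -> V) : Prop :=
  [/\ linear f, involutive f & exists2 n, n.+1 = \dim {:V} &
    exists2 H : {vspace V}, \dim H = n & fixed_points f = [set v | v \in H]].

(* The subgroup of GL(V) generated by the [s i]; inverses are not needed, since
   it is only used for involutions. *)
Inductive generated_by (I : Type) (s : I -> V -> V) : (V -> V) -> Prop :=
| generated_by_id : generated_by s id
| generated_by_comp i w : generated_by s w -> generated_by s (s i \o w).

(* The walls are H_i = fixed_points (s i), pairwise distinct. *)
Definition vinberg_pair (I : finType) (U : set V) (s : I -> V -> V) : Prop :=
  exists C : set V,
  [/\ closed_convex_polyhedral_cone C,
      U = vinterior C /\ U !=set0,
      (forall i, linear_reflection (s i)),
      injective (fun i => fixed_points (s i)) /\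
        (forall H, is_wall C H <-> exists i, H = fixed_points (s i)) &
      forall w, generated_by s w -> ((w @` U) `&` U !=set0 <-> w = id)].

(* The abstract group [W] with generators [gen] is identified by [act] with the
   subgroup of GL(V) generated by the reflections [act (gen i)]. *)
Definition vinberg_system (W : groupType) (I : finType) (gen : I -> W)
    (act : W -> V -> V) (U : set V) : Prop :=
  [/\ vinberg_pair U (fun i => act (gen i)),
      (forall w, linear (act w)),
      act 1%g = id /\ (forall w w', act (w * w')%g = act w \o act w'),
      injective act &
      forall f, (exists w, act w = f) <-> generated_by (fun i => act (gen i)) f].

End Vinberg.

(* Main.v *)
(* Both parts are instances of one theorem on a Coxeter group acting on a
   real space with a basis of coordinates (c_s) by c_t (s v) = c_t v -
   a_(s,t) c_s v, where a_(s,s) = 2, a_(s,t) = -2 cos (pi / m_(s,t)), or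
   a_(s,t) <= -2 if m_(s,t) is infinite. For W acting on Hom_R, a_(s,t) =
   FPdim r_(s,t); for the unfolded group acting on Hom_Z, a is the matrix of
   the unfolded form. Disjointness of the chambers is Tits' argument: if v
   lies in the open chamber and l(s w) >= l(w), then c_s (w v) > 0. To see
   this, one peels off from w an alternating word in s and some descent t of
   w and applies induction to the rest, which reduces the claim to a
   computation with the dihedral group of s and t: a Chebyshev recursion,
   solved by sines when m_(s,t) is finite and increasing when it is
   infinite. That the coordinates Z |-> Z (alpha_s) form a basis of the dual
   of Hom_R rests on the multiplicativity of FPdim. Right multiplication by
   the sum of the basis of R has a symmetric positive matrix, so its Perron
   eigenvector is unique up to scaling; left multiplications commute with
   it, hence act on this vector by scalars, and these are the
   values of FPdim. *)
From HB Require Import structures.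
Require Import Defs.
From mathcomp Require Import all_boot all_order all_algebra.
From mathcomp Require Import all_classical all_reals all_analysis.
From mathcomp Require Import zify ring lra.

Set Implicit Arguments.
Unset Strict Implicit.
Unset Printing Implicit Defensive.

Import Order.TTheory GRing.Theory Num.Theory.
Import numFieldNormedType.Exports.
Import VectorInternalTheory.

Local Open Scope classical_set_scope.
Local Open Scope ring_scope.

(** * Length in Coxeter groups *)

Section CoxeterLength.
Variables (S : finType) (m : coxeter_matrix S).
Implicit Types (s t : S) (w : coxeter_group m) (u : seq S).
Local Notation gen := (cox_gen m).

Lemma cox_word_cat u v : cox_word m (u ++ v) = (cox_word m u * cox_word m v)%g.
Proof. by rewrite -[RHS]/(cox_mul _ _) cox_mul_word. Qed.

Lemma cox_word_cons s u : cox_word m (s :: u) = (gen s * cox_word m u)%g.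
Proof. exact: (cox_word_cat [:: s] u). Qed.

Lemma cox_gen2 s : (gen s * gen s)%g = 1%g.
Proof. by rewrite -cox_word_cons; apply/cox_wordP/cox_eq_ss. Qed.

Lemma cox_genK s w : (gen s * (gen s * w))%g = w.
Proof. by rewrite mulgA cox_gen2 mul1g. Qed.

Lemma cox_genV s : (gen s)^-1%g = gen s.
Proof. by apply: (mulgI (gen s)); rewrite mulgV cox_gen2. Qed.

Lemma cox_len_subproof w :
  exists n, `[< exists2 u, size u = n & cox_word m u = w >].
Proof.
by exists (size (cox_repr w)); apply/asboolP; exists (cox_repr w) => //;
  exact: cox_reprK.
Qed.

Definition cox_len w := ex_minn (cox_len_subproof w).

Lemma cox_len_word u : (cox_len (cox_word m u) <= size u)%N.
Proof.
rewrite /cox_len; case: ex_minnP => n _; apply.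
by apply/asboolP; exists u.
Qed.

Lemma cox_reduced w : exists2 u, size u = cox_len w & cox_word m u = w.
Proof. by rewrite /cox_len; case: ex_minnP => n /asboolP. Qed.

Lemma cox_len_cat u w : (cox_len (cox_word m u * w)%g <= size u + cox_len w)%N.
Proof.
have [v <- <-] := cox_reduced w.
by rewrite -cox_word_cat -size_cat cox_len_word.
Qed.

Lemma cox_len_gen s w : (cox_len (gen s * w)%g <= (cox_len w).+1)%N.
Proof. exact: (cox_len_cat [:: s]). Qed.

Lemma cox_len_gen_ge s w : (cox_len w <= (cox_len (gen s * w)%g).+1)%N.
Proof. by rewrite -{1}(cox_genK s w) cox_len_gen. Qed.

Lemma cox_descent w : w <> 1%g ->
  exists s, (cox_len (gen s * w)%g < cox_len w)%N.
Proof.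
have [[|s u] su wu w1] := cox_reduced w; first by case: w1.
by exists s; rewrite -su -wu cox_word_cons cox_genK ltnS cox_len_word.
Qed.

(* The first letter is the second argument [t]. *)
Fixpoint alt_word s t k : seq S :=
  if k is k'.+1 then t :: alt_word t s k' else [::].

Lemma size_alt_word s t k : size (alt_word s t k) = k.
Proof. by elim: k s t => //= k IHk s t; rewrite IHk. Qed.

Lemma alt_wordD s t j k : alt_word s t (j + k) = alt_word s t j ++
  (if odd j then alt_word t s k else alt_word s t k).
Proof. by elim: j s t => //= j IHj s t; rewrite IHj; case: (odd j). Qed.

Lemma alt_word_double s t k : alt_word s t k.*2 = flatten (nseq k [:: t; s]).
Proof. by elim: k => //= k <-. Qed.

(** The braid form of the relation. Multiplied by [X n], the reverse of [alt_word t s n], the left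
    side becomes the n-th power of ts, and the right side cancels letter by letter from the
    middle. *)
Lemma cox_alt_word s t n : m s t = Some n ->
  cox_word m (alt_word s t n) = cox_word m (alt_word t s n).
Proof.
move=> mst; pose X k := if odd k then alt_word t s k else alt_word s t k.
apply: (mulIg (cox_word m (X n))); transitivity (1%g : coxeter_group m).
  rewrite -cox_word_cat -alt_wordD addnn alt_word_double; apply/cox_wordP.
  have := @cox_eq_rel S m [::] [::] t s n; rewrite /= cats0; apply.
  by rewrite cm_sym.
elim: {mst} n => [|n IHn]; first by rewrite mulg1.
have XS : X n.+1 = (if odd n then t else s) :: X n.
  by rewrite /X /=; case: (odd n).
have altS : alt_word t s n.+1 = alt_word t s n ++ [:: if odd n then t else s].
  by rewrite -addn1 alt_wordD; case: (odd n).
by rewrite altS XS cox_word_cat (cox_word_cons _ (X n)) -mulgA cox_genK.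
Qed.

(* After peeling off a descent, only the other letter of the pair can be the
   next one, so that the peeled letters alternate. *)
Lemma cox_peel s t w : (cox_len w <= cox_len (gen s * w)%g)%N ->
  exists k v, [/\ w = (cox_word m (alt_word s t k) * v)%g,
    cox_len w = (k + cox_len v)%N, (cox_len v <= cox_len (gen s * v)%g)%N &
    (cox_len v <= cox_len (gen t * v)%g)%N].
Proof.
have [n] := ubnP (cox_len w); elim: n => // n IHn in s t w *;
  rewrite ltnS => wn sw.
have [tw|tw] := leqP (cox_len w) (cox_len (gen t * w)%g).
  by exists 0, w; rewrite mul1g.
have [||k [v [ew lw sv tv]]] := IHn t s (gen t * w)%g.
- exact: leq_trans tw wn.
- by rewrite cox_genK ltnW.
exists k.+1, v; split=> //.
  by rewrite cox_word_cons -mulgA -ew cox_genK.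
by rewrite addSn -lw; apply/eqP; rewrite eqn_leq cox_len_gen_ge.
Qed.

End CoxeterLength.

(** * Tits' theorem on chambers *)

Section Tits.
Variables (K : realType) (S : finType) (m : coxeter_matrix S).
Variables (V : Type) (c : V -> S -> K) (a : S -> S -> K).
Variable act : coxeter_group m -> V -> V.
Hypothesis a_diag : forall s, a s s = 2.
Hypothesis a_fin : forall s t n, s != t -> m s t = Some n ->
  a s t = - (2 * cos (pi / n%:R)).
Hypothesis a_inf : forall s t, s != t -> m s t = None -> a s t <= - 2.
Hypothesis act1 : forall Z, act 1%g Z = Z.
Hypothesis actM : forall w w' Z, act (w * w')%g Z = act w (act w' Z).
Hypothesis act_gen : forall s Z t,
  c (act (cox_gen m s) Z) t = c Z t - a s t * c Z s.

Definition open_chamber : set V := [set Z | forall s, 0 < c Z s].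

Lemma coord_act_gen s Z : c (act (cox_gen m s) Z) s = - c Z s.
Proof. rewrite act_gen a_diag; ring. Qed.

(** A non-empty word here starts with [t], so [s] is the letter that may still be prefixed, and the
    sign of its coordinate is what matters. *)
Definition alt_coord s t k Z := c (act (cox_word m (alt_word s t k)) Z) s.

Lemma alt_coord0 s t Z : alt_coord s t 0 Z = c Z s.
Proof. by rewrite /alt_coord act1. Qed.

Lemma alt_coord1 s t Z : alt_coord s t 1 Z = c Z s - a t s * c Z t.
Proof. exact: act_gen. Qed.

(** The leading [t] contributes the [t]-coordinate, while the [s] after it has just negated the
    [s]-coordinate. *)
Lemma alt_coordSS s t k Z :
  alt_coord s t k.+2 Z = - a t s * alt_coord t s k.+1 Z - alt_coord s t k Z.
Proof.
rewrite /alt_coord [alt_word s t k.+2]/= cox_word_cons actM act_gen.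
rewrite {1}cox_word_cons actM coord_act_gen; ring.
Qed.

Lemma alt_coord_inf s t k Z : s != t -> m s t = None ->
  0 < c Z s -> 0 < c Z t -> 0 < alt_coord s t k Z.
Proof.
(* Positivity alone does not pass through the recursion; it is proved together with growth, since a
   coefficient of at least 2 gives x_(k+2) - x_(k+1) >= x_(k+1) - x_k. *)
move=> st mst; wlog suff : s t st mst / 0 < c Z s -> 0 < c Z t ->
    0 < alt_coord s t k Z /\ alt_coord s t k Z <= alt_coord t s k.+1 Z.
  by move=> H Zs Zt; have [] := H s t st mst Zs Zt.
elim: k => [|k IHk] in s t st mst * => Zs Zt.
  rewrite alt_coord0 alt_coord1 Zs; split=> //.
  have := a_inf st mst; nra.
have ts : t != s by rewrite eq_sym.
have mts : m t s = None by rewrite cm_sym.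
have [tk tkS] := IHk _ _ ts mts Zt Zs.
split; first exact: lt_le_trans tkS.
rewrite alt_coordSS; have := a_inf st mst; nra.
Qed.

Lemma alt_coord_fin s t n k Z : s != t -> m s t = Some n ->
  sin (pi / n%:R) * alt_coord s t k Z =
  sin (pi / n%:R *+ k.+1) * c Z (if odd k then t else s) +
  sin (pi / n%:R *+ k) * c Z (if odd k then s else t).
Proof.
move=> + mst; set th := pi / n%:R.
have sinSS j : sin (th *+ j.+2) = 2 * cos th * sin (th *+ j.+1) - sin (th *+ j).
  rewrite (mulrS th j.+1) sinD -[in X in _ - X](addrK th (th *+ j)) -mulrSr sinB.
  ring.
(* The recursion reaches back two steps and swaps the letters, so the induction carries two
   consecutive indices and both orders of the pair. *)
suff: s != t -> forall x y, (x = s /\ y = t) \/ (x = t /\ y = s) ->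
  sin th * alt_coord x y k Z =
   sin (th *+ k.+1) * c Z (if odd k then y else x) +
   sin (th *+ k) * c Z (if odd k then x else y) /\
  sin th * alt_coord x y k.+1 Z =
   sin (th *+ k.+2) * c Z (if odd k then x else y) +
   sin (th *+ k.+1) * c Z (if odd k then y else x).
  by move=> H st; have [] := H st s t (or_introl (conj erefl erefl)).
move=> st.
have aE x y : (x = s /\ y = t) \/ (x = t /\ y = s) -> a y x = - (2 * cos th).
  case=> -[-> ->]; apply: a_fin => //; first by rewrite eq_sym.
  by rewrite cm_sym.
elim: k => [|k IHk] x y xy.
  rewrite alt_coord0 alt_coord1 (aE _ _ xy) /= sinSS mulr0n mulr1n sin0;
    split; ring.
have yx : (y = s /\ x = t) \/ (y = t /\ x = s) by case: xy => -[-> ->]; auto.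
have [_ IHx] := IHk _ _ xy; have [IHy _] := IHk _ _ xy.
have [_ IHy'] := IHk _ _ yx.
rewrite alt_coordSS (aE _ _ xy) /=.
split; first by rewrite IHx; case: (odd k).
rewrite mulrBr (_ : sin th * (_ * _) = 2 * cos th * (sin th * alt_coord y x
  k.+1 Z)); last by ring.
rewrite IHy' IHy (sinSS k.+1) (sinSS k); case: (odd k) => /=; ring.
Qed.

Lemma alt_coord_fin_gt0 s t n k Z : s != t -> m s t = Some n -> (k < n)%N ->
  0 < c Z s -> 0 < c Z t -> 0 < alt_coord s t k Z.
Proof.
move=> st mst kn Zs Zt.
have n2 : (2 <= n)%N by have := cm_off m st; rewrite mst.
have n0 : 0 < n%:R :> K by rewrite ltr0n; exact: leq_trans n2.
have sin_pos j : (0 < j < n)%N -> 0 < sin (pi / n%:R *+ j) :> K.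
  move=> /andP[j0 jn]; have pi0 := pi_gt0 K; apply: sin_gt0_pi; apply/andP;
    split.
    by rewrite pmulrn_lgt0 // divr_gt0.
  by rewrite -mulr_natr mulrAC ltr_pdivrMr // ltr_pM2l // ltr_nat.
have th0 : 0 < sin (pi / n%:R) :> K by have := sin_pos 1%N; rewrite mulr1n;
  apply.
rewrite -(pmulr_rgt0 _ th0) (alt_coord_fin _ _ st mst).
have pos j : 0 < c Z (if odd j then t else s) /\
    0 < c Z (if odd j then s else t).
  by case: (odd j).
have [p1 p2] := pos k.
case: k kn p1 p2 => [|k] kn p1 p2.
  by rewrite mulr0n mulr1n sin0 mul0r addr0 mulr_gt0.
(* The leading angle may reach pi, when [k.+2 = n]; its sine then vanishes, so strict positivity is
   drawn from the other term. *)
apply: ltr_wpDl; last by rewrite mulr_gt0 // sin_pos.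
move: kn; rewrite leq_eqVlt => /orP[/eqP kn|kn];
  last by rewrite mulr_ge0 ?ltW // sin_pos.
by rewrite -kn -[_ *+ k.+2]mulr_natr mulfVK ?sinpi ?mul0r // kn gt_eqF.
Qed.

Lemma chamber_coord_gt0 s w Z : open_chamber Z ->
  (cox_len w <= cox_len (cox_gen m s * w)%g)%N -> 0 < c (act w Z) s.
Proof.
move=> Z0; have [n] := ubnP (cox_len w); elim: n => // n IHn in s w *.
rewrite ltnS => wn sw.
have [->|/eqP/cox_descent[t tw]] := eqVneq w 1%g; first by rewrite act1.
have st : s != t by apply: contraTneq tw => <-; rewrite -leqNgt.
have [k [v [ew lw sv tv]]] := cox_peel t sw.
(* The descent [t] of [w] is not one of [v], so at least one letter was peeled and [v] is shorter
   than [w]. *)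
have k0 : (0 < k)%N.
  case: k ew lw => // ew lw; move: tw; rewrite ew mul1g ltnNge.
  by rewrite tv.
have vn : (cox_len v < n)%N.
  by apply: leq_trans wn; rewrite lw -addn1 addnC leq_add2r.
have Zs := IHn _ _ vn sv; have Zt := IHn _ _ vn tv.
rewrite ew actM; case mst : (m s t) => [q|]; last exact: alt_coord_inf.
(* If [q <= k], the braid relation would let the peeled word start with [s], making [s] a descent of
   [w]. *)
apply: (alt_coord_fin_gt0 st mst) => //; rewrite ltnNge; apply/negP => qk.
have [p p1] : exists p, q = p.+1.
  have := cm_off m st; rewrite mst; case: q {mst qk} => // p _; by exists p.
move: sw; rewrite {2}ew -(subnKC qk) alt_wordD cox_word_cat (cox_alt_word mst).
rewrite {1}p1 /= cox_word_cons -!mulgA cox_genK mulgA -cox_word_cat.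
move=> /leq_trans/(_ (cox_len_cat _ _)).
rewrite size_cat size_alt_word lw leq_add2r.
by case: (odd q); rewrite size_alt_word -{1}(subnKC qk) leq_add2r p1 ltnn.
Qed.

(** For a descent [s] of [w], the element [s w] has no descent at [s], so the [s]-coordinate is
    positive at [s w Z] and hence negative at [w Z]. *)
Theorem chamber_disjoint w : (act w @` open_chamber) `&` open_chamber !=set0 ->
  w = 1%g.
Proof.
case=> _ [[Z Z0 <-] wZ0]; apply: contrapT => /cox_descent[s sw].
have := chamber_coord_gt0 (s := s) (w := (cox_gen m s * w)%g) Z0.
rewrite cox_genK ltnW // => /(_ isT); rewrite actM coord_act_gen oppr_gt0.
by rewrite ltNge ltW.
Qed.

End Tits.

(** * Perron-Frobenius for symmetric positive matrices *)

Section Perron.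
Variable K : realType.

Lemma mulmx_coord_continuous n p (A : 'M[K]_(n, p)) j :
  continuous (fun x : 'rV[K]_n => (x *m A) 0 j).
Proof.
rewrite (_ : (fun x => _) = fun x : 'rV[K]_n => \sum_i x 0 i * A i j);
  last first.
  by apply/funext => x; rewrite mxE.
apply: (continuous_big add_continuous) => i _ x.
apply: (continuousM (s := fun x : 'rV[K]_n => x 0 i));
  first exact: coord_continuous.
exact: cst_continuous.
Qed.

(** The linear coefficient vanishes at a minimum. The test value has denominator [g + 1] because [g]
    may be 0. *)
Lemma quadratic_min_eq0 (b g : K) : 0 <= g ->
  (forall t, 0 <= t * b *+ 2 + t ^+ 2 * g) -> b = 0.
Proof.
move=> g0 /(_ (- b / (g + 1))) H.
have g1 : 0 < g + 1 by rewrite ltr_wpDl.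
apply/eqP; rewrite -sqrf_eq0 eq_le sqr_ge0 andbT.
move: H; rewrite (_ : _ + _ = - (b ^+ 2 * ((g + 2) / (g + 1) ^+ 2)));
  last first.
  by field; rewrite gt_eqF.
rewrite oppr_ge0 pmulr_lle0 // divr_gt0 ?exprn_gt0 //.
by rewrite ltr_wpDl.
Qed.

Variable n : nat.
Implicit Types (x y z : 'rV[K]_n) (M : 'M[K]_n).

(** * Scalar product, Rayleigh quotient and positive eigenvectors *)

Definition dot x y : K := \sum_i x 0 i * y 0 i.

Lemma dotC x y : dot x y = dot y x.
Proof. by apply: eq_bigr => i _; rewrite mulrC. Qed.

Lemma dotDl x y z : dot (x + y) z = dot x z + dot y z.
Proof. by rewrite -big_split; apply: eq_bigr => i _; rewrite mxE mulrDl. Qed.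

Lemma dotZl t x y : dot (t *: x) y = t * dot x y.
Proof. by rewrite mulr_sumr; apply: eq_bigr => i _; rewrite mxE mulrA. Qed.

Lemma dotDr x y z : dot z (x + y) = dot z x + dot z y.
Proof. by rewrite !(dotC z) dotDl. Qed.

Lemma dotZr t x y : dot x (t *: y) = t * dot x y.
Proof. by rewrite !(dotC x) dotZl. Qed.

Lemma dot_delta x i : dot x (delta_mx 0 i) = x 0 i.
Proof.
rewrite /dot (bigD1 i) //= mxE !eqxx mulr1 big1 ?addr0 // => j /negPf ji.
by rewrite mxE ji mulr0.
Qed.

Lemma dotxx_ge0 x : 0 <= dot x x.
Proof. by apply: sumr_ge0 => i _; rewrite -expr2 sqr_ge0. Qed.

Lemma dotxx_eq0 x : (dot x x == 0) = (x == 0).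
Proof.
apply/eqP/eqP => [x0|->]; last by rewrite /dot big1 // => i _;
  rewrite mxE mul0r.
apply/rowP => i; rewrite mxE; apply/eqP; rewrite -sqrf_eq0 expr2.
by rewrite (psumr_eq0P _ x0) // => j _; rewrite -expr2 sqr_ge0.
Qed.

Lemma quadratic_continuous M : continuous (fun x => dot (x *m M) x).
Proof.
apply: (continuous_big add_continuous) => i _ x.
apply: (continuousM (s := fun x => (x *m M) 0 i)); last exact: coord_continuous.
exact: mulmx_coord_continuous.
Qed.

Lemma unit_sphere_compact : compact [set x | dot x x = 1].
Proof.
apply: (@subclosed_compact _ _
    [set x : 'rV[K]_n | forall i, x ord0 i \in `[-1, 1]]).
- rewrite (_ : mkset _ = (fun x => dot (x *m 1%:M) x) @^-1` [set y | y = 1]).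
    by apply: preimage_closed => // x _; exact: quadratic_continuous.
  by apply/funext => x; rewrite /= mulmx1.
- apply: (@rV_compact _ _ (fun=> `[(-1 : K), 1]%classic)) => i;
    exact: segment_compact.
- move=> x /= x1 i; rewrite in_itv /= -ler_norml -(@expr_le1 _ 2) //.
  rewrite real_normK ?num_real // -x1 /dot (bigD1 i) //= -expr2 lerDl.
  by apply: sumr_ge0 => j _; rewrite -expr2 sqr_ge0.
Qed.

Lemma dot_mulmx_sym M x y : M^T = M -> dot (x *m M) y = dot x (y *m M).
Proof.
move=> Msym; have dotE u v : dot u v = (u *m v^T) 0 0.
  by rewrite mxE; apply: eq_bigr => i _; rewrite mxE.
by rewrite !dotE trmx_mul Msym mulmxA.
Qed.

(** The maximum is attained on the compact unit sphere and extends to all vectors by homogeneity. *)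
Lemma quadratic_max M : (0 < n)%N -> exists x, dot x x = 1 /\
  forall y, dot (y *m M) y <= dot (x *m M) x * dot y y.
Proof.
move=> n0; have [||x + xmax] := EVT_max_rV (f :=
  fun x => dot (x *m M) x) _ unit_sphere_compact.
- by exists (delta_mx 0 (Ordinal n0)); rewrite /= dot_delta mxE !eqxx.
- by apply: continuous_subspaceT; exact: quadratic_continuous.
rewrite inE /= => x1; exists x; split=> // y.
have [->|y0] := eqVneq y 0.
  by rewrite mul0mx (eqP (_ : dot 0 0 == 0)) ?mulr0 // dotxx_eq0.
have yy : 0 < dot y y by rewrite lt_neqAle eq_sym dotxx_eq0 y0 dotxx_ge0.
have := xmax ((Num.sqrt (dot y y))^-1 *: y);
  rewrite inE /= -scalemxAl !dotZl !dotZr.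
rewrite !mulrA -expr2 exprVn sqr_sqrtr ?dotxx_ge0 // mulVf ?gt_eqF //.
move=> /(_ erefl).
by rewrite ler_pdivrMl // mulrC.
Qed.

(* The vector of moduli of a maximiser of the Rayleigh quotient is again one. *)
Lemma symmetric_perron M : (0 < n)%N -> M^T = M -> (forall i j, 0 < M i j) ->
  exists l x, [/\ forall i, 0 < x 0 i, x *m M = l *: x &
    forall y, y *m M = l *: y -> exists t, y = t *: x].
Proof.
move=> n0 Msym Mpos; have [c [c1 cmax]] := quadratic_max M n0.
set l := dot (c *m M) c in cmax.
have [x xE] : exists x : 'rV[K]_n, forall i, x 0 i = `|c 0 i|.
  by exists (map_mx Num.norm c) => i; rewrite mxE.
have x1 : dot x x = 1.
  by rewrite -c1; apply: eq_bigr => i _;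
    rewrite !xE -expr2 real_normK ?num_real.
have xl : dot (x *m M) x = l.
  apply/eqP; rewrite eq_le; apply/andP; split; first by have := cmax x;
    rewrite x1 mulr1.
  apply: le_trans (ler_norm _) _; apply: le_trans (ler_norm_sum _ _ _) _.
  apply: ler_sum => i _; rewrite normrM xE ler_wpM2r // !mxE.
  apply: le_trans (ler_norm_sum _ _ _) _; apply: ler_sum => j _.
  by rewrite normrM xE ler_wpM2l // ger0_norm // ltW.
(* The first variation at the maximiser [x] vanishes in every coordinate direction, which is the
   eigenvector equation. *)
have eig : x *m M = l *: x.
  apply/rowP => i; rewrite -!(dot_delta _ i).
  apply/eqP; rewrite dotZl eq_sym -subr_eq0; apply/eqP.
  set d := delta_mx 0 i.
  apply: (@quadratic_min_eq0 _ (l * dot d d - dot (d *m M) d)).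
    by rewrite subr_ge0 cmax.
  move=> t; have := cmax (x + t *: d); rewrite -subr_ge0.
  rewrite mulmxDl -scalemxAl !(dotDl, dotDr, dotZl, dotZr) x1 xl.
  rewrite (dot_mulmx_sym d) // (dotC d (x *m M)) (dotC d x).
  by congr (0 <= _); ring.
(* Since [x] is non-negative and non-zero, [x *m M] is positive everywhere, and the eigenvector
   equation leaves no zero coordinate. *)
have xpos i : 0 < x 0 i.
  have [j xj] : exists j, 0 < x 0 j.
    apply: contrapT => x0; have /eqP := x1;
      rewrite /dot big1 ?(eq_sym 0) ?oner_eq0 // => j _.
    have [->|xj] := eqVneq (x 0 j) 0; first by rewrite mul0r.
    by case: x0; exists j; rewrite lt_neqAle eq_sym xj xE normr_ge0.
  have : 0 < l * x 0 i.
    have -> : l * x 0 i = (x *m M) 0 i by rewrite eig mxE.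
    rewrite mxE (bigD1 j) //= ltr_pwDl ?mulr_gt0 //; apply: sumr_ge0 => k _.
    by rewrite mulr_ge0 ?(ltW (Mpos _ _)) ?xE.
  rewrite lt_neqAle eq_sym mulf_eq0 negb_or => /andP[/andP[_ xi0] _].
  by rewrite lt_neqAle eq_sym xi0 xE normr_ge0.
exists l, x; split=> // y yl.
(* Simplicity: subtract the largest multiple of [x] that keeps the difference [z] non-negative. Then
   [z *m M] vanishes at [k], and positivity of [M] forces [z] to be zero. *)
pose k := [arg min_(i < Ordinal n0) (y 0 i / x 0 i)]%O.
have kmin i : y 0 k / x 0 k <= y 0 i / x 0 i.
  by rewrite /k; case: arg_minP => // j _; apply.
exists (y 0 k / x 0 k); set t := _ / _ in kmin *.
pose z := y - t *: x.
have zE i : z 0 i = y 0 i - t * x 0 i by rewrite !mxE.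
have z0 i : 0 <= z 0 i by rewrite zE subr_ge0 -ler_pdivlMr.
have : (z *m M) 0 k = 0.
  rewrite mulmxBl -scalemxAl eig yl !mxE mulrCA -mulrBr /t mulfVK ?gt_eqF //.
  by rewrite subrr mulr0.
rewrite mxE => /psumr_eq0P zM; apply/rowP => i; apply/eqP.
rewrite [X in _ == X]mxE -subr_eq0 -zE.
have /eqP := zM (fun j _ => mulr_ge0 (z0 j) (ltW (Mpos j k))) i isT.
by rewrite mulf_eq0 (gt_eqF (Mpos _ _)) orbF.
Qed.

(* Comparing the moduli of any eigenvector with a positive one at the index
   where their ratio is largest. *)
Lemma eigenvalue_le_positive M x a b : (forall i j, 0 <= M i j) ->
  (forall i, 0 < x 0 i) -> x *m M = b *: x ->
  0 <= a -> eigenvalue M a -> a <= b.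
Proof.
move=> M0 xpos xb a0 /eigenvalueP[u ua u0].
have [i0 ui0] : exists i, u 0 i != 0.
  apply: contrapT => H; case/eqP: u0; apply/rowP => i; rewrite mxE.
  by apply/eqP; apply: contrapT => /negP ui; apply: H; exists i.
pose k := [arg max_(i > i0) (`|u 0 i| / x 0 i)]%O.
have kmax i : `|u 0 i| / x 0 i <= `|u 0 k| / x 0 k.
  by rewrite /k; case: arg_maxP => // j _; apply.
have uk : 0 < `|u 0 k|.
  have : 0 < `|u 0 k| / x 0 k by apply: lt_le_trans (kmax i0);
    rewrite divr_gt0 ?normr_gt0.
  by rewrite pmulr_lgt0 // invr_gt0.
rewrite -(ler_pM2r uk) -{1}(ger0_norm a0) -normrM.
have -> : a * u 0 k = (u *m M) 0 k by rewrite ua mxE.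
have -> : b * `|u 0 k| = `|u 0 k| / x 0 k * (x *m M) 0 k.
  by rewrite xb mxE [RHS]mulrCA divfK ?gt_eqF.
rewrite !mxE mulr_sumr; apply: le_trans (ler_norm_sum _ _ _) _.
apply: ler_sum => i _; rewrite normrM mulrA (ger0_norm (M0 _ _)) ler_wpM2r //.
by rewrite -ler_pdivrMr.
Qed.

End Perron.

(** * Frobenius-Perron dimension *)

Section FrobeniusPerron.
Variables (K : realType) (R : nzRingType) (B : finType) (F : fusion_ring R B).
Implicit Types (x y z : R) (f g : R -> R).

Lemma fr_coord_sum (I : finType) (G : I -> R) i :
  fr_coord F (\sum_j G j) i = \sum_j fr_coord F (G j) i.
Proof.
exact: (big_morph _ (fun x y => fr_coordD F x y i) (fr_coord0 F i)).
Qed.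

Lemma fr_coordMz x (n : int) i : fr_coord F (x *~ n) i = fr_coord F x i * n.
Proof.
have nat_case (k : nat) : fr_coord F (x *+ k) i = fr_coord F x i * k%:Z.
  elim: k => [|k IHk]; first by rewrite mulr0n mulr0 fr_coord0.
  by rewrite mulrSr fr_coordD IHk intS; ring.
case: n => k; first by rewrite -pmulrn nat_case.
by rewrite NegzE mulrNz -pmulrn fr_coordN nat_case mulrN.
Qed.

Lemma fr_nneg_mul x y : fr_nneg F x -> fr_nneg F y -> fr_nneg F (x * y).
Proof.
move=> x0 y0 i; rewrite [x](fr_expand F) [y](fr_expand F) mulr_suml
  fr_coord_sum.
apply: sumr_ge0 => j _; rewrite mulr_sumr fr_coord_sum; apply: sumr_ge0 => k _.
by rewrite mulrzAl mulrzAr !fr_coordMz !mulr_ge0 ?x0 ?y0 ?fr_coord_ge0.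
Qed.

(** Matrices act on rows from the right, which reverses composition. For left multiplication by a
    basis element this is [fusion_mx]. *)
Definition op_mx f : 'M[K]_#|B| :=
  \matrix_(k, l) (fr_coord F (f (F (enum_val k))) (enum_val l))%:~R.

Lemma op_mx_comp f g : {morph g : x y / x - y} ->
  op_mx f *m op_mx g = op_mx (g \o f).
Proof.
move=> gB; pose gA : {additive R -> R} :=
  HB.pack g (GRing.isZmodMorphism.Build R R g gB).
apply/matrixP => k l; rewrite !mxE /= [in RHS](fr_expand F (f _)).
rewrite -[g (\sum_i _)]/(gA _) raddf_sum fr_coord_sum raddf_sum /=.
rewrite [RHS](reindex (fun i : 'I_#|B| => enum_val i)) /=;
  last exact: onW_bij (enum_val_bij _).
apply: eq_bigr => i _; rewrite !mxE -[g (_ *~ _)]/(gA _) raddfMz.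
by rewrite fr_coordMz rmorphM mulrC.
Qed.

Lemma left_right_commute x y :
  op_mx ( *%R x) *m op_mx ( *%R^~ y) = op_mx ( *%R^~ y) *m op_mx ( *%R x).
Proof.
rewrite !op_mx_comp => [|u v|u v]; last 2 first.
- exact: mulrBr.
- exact: mulrBl.
by congr op_mx; apply/funext => z /=; rewrite mulrA.
Qed.

Let basis_sum := \sum_b F b.

(** The coefficient of [F j] is that of 1 after left multiplication by the dual of [F j]; the same
    duality on the right turns each summand [F b] into a coordinate of the remaining product. *)
Lemma basis_sum_coord i j :
  fr_coord F (F i * basis_sum) j = \sum_b fr_coord F (F (fr_star F j) * F i) b.
Proof.
rewrite -fr_trace_basis mulrA mulr_sumr fr_coord_sum.
rewrite [RHS](reindex_inj (inv_inj (fr_starK F))).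
by apply: eq_bigr => b _; exact: fr_tracer.
Qed.

(** The entry sums the non-negative coordinates of a product of two basis elements, and such a
    product is non-zero. *)
Lemma basis_sum_coord_gt0 i j : 0 < fr_coord F (F i * basis_sum) j.
Proof.
rewrite basis_sum_coord lt_neqAle eq_sym sumr_ge0 ?andbT => [|b _];
  last exact: fr_coord_ge0.
apply/negP => /eqP /psumr_eq0P => H.
have /eqP := fr_mul_neq0 F (fr_star F j) i; apply.
rewrite [LHS](fr_expand F) big1 // => b _; rewrite H ?mulr0z // => *.
exact: fr_coord_ge0.
Qed.

(** The involution exchanges the roles of [i] and [j] in that product and only permutes its
    coordinates. *)
Lemma basis_sum_coord_sym i j :
  fr_coord F (F i * basis_sum) j = fr_coord F (F j * basis_sum) i.
Proof.
rewrite !basis_sum_coord [RHS](reindex_inj (inv_inj (fr_starK F))).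
apply: eq_bigr => b _; rewrite -fr_coord_star starRM !starR_basis fr_starK.
by [].
Qed.

(** Left multiplications preserve the Perron line of right multiplication by [basis_sum]. The scalar
    of a basis element has a positive eigenvector, so it is the largest non-negative eigenvalue,
    that is, the supremum in [FPdim_basis]; linearity gives the rest. *)
Lemma FPdim_character : exists2 x : 'rV[K]_#|B|,
  forall i, 0 < x 0 i & forall y, x *m op_mx ( *%R y) = FPdim F K y *: x.
Proof.
have B0 : (0 < #|B|)%N by apply/card_gt0P; exists (fr_one F).
have [|||l [x [xpos xl simple]]] :=
    @symmetric_perron K _ (op_mx ( *%R^~ basis_sum)).
- exact: B0.
- by apply/matrixP => i j; rewrite !mxE /= basis_sum_coord_sym.
- by move=> i j; rewrite mxE ltr0z basis_sum_coord_gt0.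
exists x => //.
have eig y : exists t, x *m op_mx ( *%R y) = t *: x.
  by apply: simple; rewrite -mulmxA left_right_commute mulmxA xl scalemxAl.
have eig_basis j : x *m op_mx ( *%R (F j)) = FPdim_basis F K j *: x.
  have [t xt] := eig (F j); rewrite xt; congr (_ *: _).
  have pos i k : 0 <= op_mx ( *%R (F j)) i k by rewrite mxE ler0z fr_coord_ge0.
  have t0 : 0 <= t.
    have i0 := Ordinal B0; rewrite -(pmulr_lge0 _ (xpos i0)).
    have -> : t * x 0 i0 = (x *m op_mx ( *%R (F j))) 0 i0 by rewrite xt mxE.
    by rewrite mxE sumr_ge0 // => i _; rewrite mulr_ge0 // ltW.
  have ubt : ubound [set a : K | 0 <= a /\ eigenvalue (fusion_mx F K j) a] t.
    by move=> a [a0 /(eigenvalue_le_positive pos xpos xt a0)].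
  have mt : [set a : K | 0 <= a /\ eigenvalue (fusion_mx F K j) a] t.
    split=> //; apply/eigenvalueP; exists x => //; apply/eqP => x0.
    by have := xpos (Ordinal B0); rewrite x0 mxE ltxx.
  apply/eqP; rewrite eq_le; apply/andP; split.
    by apply: ub_le_sup => //; exists t.
  by apply: ge_sup => //; exists t.
move=> y; rewrite /FPdim scaler_suml.
under eq_bigr => i _ do rewrite -scalerA -eig_basis scalemxAr.
rewrite -mulmx_sumr; congr (_ *m _); apply/matrixP => i j.
rewrite summxE mxE [in LHS](fr_expand F y) mulr_suml fr_coord_sum rmorph_sum.
apply: eq_bigr => b _ /=; rewrite !mxE mulrzAl fr_coordMz rmorphM mulrC.
by [].
Qed.

Lemma FPdimD x y : FPdim F K (x + y) = FPdim F K x + FPdim F K y.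
Proof.
rewrite /FPdim -big_split; apply: eq_bigr => i _.
by rewrite fr_coordD rmorphD mulrDl.
Qed.

Lemma FPdim1 : FPdim F K 1 = 1.
Proof.
have [x xpos xD] := FPdim_character.
have i0 := Ordinal (ltac:(by apply/card_gt0P;
  exists (fr_one F)) : (0 < #|B|)%N).
have := xD 1; rewrite (_ : op_mx _ = 1%:M).
  rewrite mulmx1 => /rowP/(_ i0); rewrite mxE -{1}[x 0 i0]mul1r => /mulIf -> //.
  by rewrite gt_eqF.
apply/matrixP => k l; rewrite !mxE mul1r fr_coord_basis.
by rewrite (inj_eq enum_val_inj) eq_sym; case: eqP.
Qed.

(** Scalars on the common eigenvector multiply; the reversed order of the matrices is absorbed by
    commutativity of [K]. *)
Lemma FPdimM x y : FPdim F K (x * y) = FPdim F K x * FPdim F K y.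
Proof.
have [v vpos vD] := FPdim_character.
have i0 := Ordinal (ltac:(by apply/card_gt0P;
  exists (fr_one F)) : (0 < #|B|)%N).
have := vD (x * y); rewrite (_ : op_mx _ = op_mx ( *%R y) *m op_mx ( *%R x)).
  rewrite mulmxA vD -scalemxAl vD scalerA => /rowP/(_ i0); rewrite !mxE.
  by move=> /mulIf <-; rewrite ?gt_eqF // mulrC.
rewrite op_mx_comp => [|a b]; last exact: mulrBr.
by congr op_mx; apply/funext => z /=; rewrite mulrA.
Qed.

End FrobeniusPerron.

(** * Simplicial cones *)

Section SimplicialCone.
Variables (K : realType) (V : vectType K) (I : finType).
Variables (c : I -> 'Hom(V, K^o)) (e : I -> V).
Hypothesis c_dual : forall i j, c i (e j) = (i == j)%:R.
Hypothesis c_expand : forall v, v = \sum_i c i v *: e i.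

Definition cone : set V := [set v | forall i, 0 <= c i v].
Definition open_cone : set V := [set v | forall i, 0 < c i v].
Definition coord_plane i : set V := [set v | c i v = 0].

Lemma coord_ext u v : (forall i, c i u = c i v) -> u = v.
Proof.
by move=> uv; rewrite (c_expand u) (c_expand v); apply: eq_bigr => i _;
  rewrite uv.
Qed.

(** Such vectors lie in the span of the [e i] with [i] in [P]. *)
Lemma free_size_le (P : {pred I}) (X : seq V) : free X ->
  {in X, forall x i, i \notin P -> c i x = 0} -> (size X <= #|P|)%N.
Proof.
move=> /eqP <- X0; set Y := [seq e i | i <- enum P].
have sY : size Y = #|P| by rewrite size_map cardE.
rewrite -sY; apply: leq_trans (dim_span Y); apply/dimvS/span_subvP => x xX.
rewrite (c_expand x) (bigID (mem P)) /= [X in _ + X]big1 ?addr0 => [|i iP].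
  by apply: memv_suml => i iP; rewrite memvZ // memv_span // map_f // mem_enum.
by rewrite X0 // scale0r.
Qed.

Definition dual_subbasis (P : {pred I}) := [tuple e (enum_val i) | i < #|P|].

Lemma dual_subbasis_free P : free (dual_subbasis P).
Proof.
apply/freeP => k k0 i.
have nthE (j : 'I_#|P|) : (dual_subbasis P)`_j = e (enum_val j).
  by rewrite -tnth_nth tnth_mktuple.
have := congr1 (c (enum_val i)) k0; rewrite linear_sum linear0 (bigD1 i) //=.
rewrite big1 => [|j ji]; rewrite nthE linearZ /= c_dual.
  by rewrite eqxx addr0 => <-; exact: esym (mulr1 _).
by rewrite (inj_eq enum_val_inj) eq_sym (negPf ji); exact: mulr0.
Qed.

Lemma dual_subbasisP (P : {pred I}) x :
  x \in dual_subbasis P -> exists2 i, i \in P & x = e i.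
Proof. by case/mapP => i _ ->; exists (enum_val i) => //; exact: enum_valP. Qed.

Lemma dim_vect : \dim {:V} = #|I|.
Proof.
have -> : #|I| = #|(predT : pred I)| by exact: eq_card.
apply/eqP; rewrite eqn_leq; apply/andP; split.
  rewrite -(size_tuple (vbasis {:V})); apply: free_size_le => //.
  exact: basis_free (vbasisP _).
have /eqP := dual_subbasis_free (predT : pred I); rewrite size_tuple => <-.
exact: dimvS (subvf _).
Qed.

Lemma card_predC1S (i : I) : #|predC1 i|.+1 = \dim {:V}.
Proof. by rewrite dim_vect cardC1 prednK //; apply/card_gt0P; exists i. Qed.

Lemma dim_lker_coord i : \dim (lker (c i)) = #|predC1 i|.
Proof.
apply/eqP; rewrite eqn_leq; apply/andP; split.
  rewrite -(size_tuple (vbasis (lker (c i)))); apply: free_size_le.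
    exact: basis_free (vbasisP _).
  move=> x /vbasis_mem; rewrite memv_ker => /eqP x0 j.
  by rewrite !inE negbK => /eqP ->.
have /eqP := dual_subbasis_free (predC1 i); rewrite size_tuple => <-.
apply/dimvS/span_subvP => x /dual_subbasisP[j ji ->].
by rewrite memv_ker c_dual (eq_sym i); move: ji; rewrite !inE => /negPf ->.
Qed.

(** A functional non-negative on the cone has non-negative coefficients, so on its zero face every
    coordinate with non-zero coefficient vanishes. Two such coordinates would give the face
    codimension at least 2, so the functional is a multiple of a single coordinate. *)
Lemma is_wall_cone X : is_wall cone X <-> exists i, X = coord_plane i.
Proof.
split=> [[[f [f0 -> fC]] [n nV [[Y [YC Yfree Yn]] _]]]|[i ->]].
  have fE v : f v = \sum_i c i v * f (e i).
    by rewrite {1}(c_expand v) linear_sum; apply: eq_bigr => i _;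
      rewrite linearZ.
  have fe i : 0 <= f (e i).
    by apply: fC => j; rewrite c_dual ler0n.
  have [i fi] : exists i, f (e i) != 0.
    apply: contrapT => H; case/eqP: f0; apply/lfunP => v.
    rewrite fE big1 ?lfunE // => i _; have [->|fi] := eqVneq (f (e i)) 0;
      first exact: mulr0.
    by case: H; exists i.
  exists i.
  have Y0 j : f (e j) != 0 -> {in Y, forall y, c j y = 0}.
    move=> fj y /YC[yC /= /eqP]; rewrite fE => /eqP /psumr_eq0P => H.
    have /eqP : c j y * f (e j) = 0 by apply: H => // k _;
      rewrite mulr_ge0 // yC.
    by rewrite mulf_eq0 (negPf fj) orbF => /eqP.
  have fj j : j != i -> f (e j) = 0.
    move=> ji; apply: contrapT => /eqP fj.
    have : (size Y <= #|[pred k | (k != i) && (k != j)]|)%N.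
      apply: free_size_le => // y yY k; rewrite !inE negb_and !negbK.
      by case/orP => /eqP ->; exact: Y0 yY.
    have := cardD1 j (predC1 i); rewrite !inE ji => cD.
    rewrite Yn -ltnS nV -(card_predC1S i) cD ltnS add1n.
    rewrite (eq_card (B := [pred k | (k != i) && (k != j)])) ?ltnn // => k.
    by rewrite !inE andbC.
  have fcE v : f v = c i v * f (e i).
    by rewrite fE (bigD1 i) //= big1 ?addr0 // => j /fj ->; exact: mulr0.
  apply/seteqP; split=> v /=; rewrite fcE; last by move=> ->; exact: mul0r.
  by move/eqP; rewrite mulf_eq0 (negPf fi) orbF => /eqP.
split.
  exists (c i); split=> [|//|v /(_ i)//].
  apply/eqP => ci; have := c_dual i i; rewrite ci lfunE /= eqxx => /eqP.
  by rewrite eq_sym oner_eq0.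
exists #|predC1 i|; first exact: card_predC1S.
split.
  exists (dual_subbasis (predC1 i)); split;
    [|exact: dual_subbasis_free|exact: size_tuple].
  move=> x /dual_subbasisP[j ji ->]; split=> [k|];
    rewrite /coord_plane /= c_dual ?ler0n //.
  by rewrite (eq_sym i); move: ji; rewrite !inE => /negPf ->.
move=> Y YC Yfree; apply: free_size_le => // x xY j.
by rewrite !inE negbK => /eqP ->; have [] := YC x xY.
Qed.

Lemma coord_continuous_rV i :
  continuous (fun x : 'rV[K]_(dim V) => c i (r2v x) : K).
Proof.
pose A : 'M[K]_(dim V, 1) := \matrix_(k, j) c i (r2v (delta_mx 0 k)).
rewrite (_ : (fun x => _) = fun x : 'rV[K]_(dim V) => (x *m A) 0 0).
  exact: mulmx_coord_continuous.
apply/funext => x; rewrite {1}(row_sum_delta x) !linear_sum mxE.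
by apply: eq_bigr => k _; rewrite !linearZ mxE.
Qed.

Lemma cone_closed_convex_polyhedral : closed_convex_polyhedral_cone cone.
Proof.
split.
- rewrite /vclosed (_ : mkset _ = \bigcap_i
      ((fun x : 'rV[K]_(dim V) => c i (r2v x) : K) @^-1` [set y | 0 <= y])).
    apply: closed_bigI => i _; apply: preimage_closed => // x _.
    exact: coord_continuous_rV.
  by apply/seteqP; split=> [x xC i _|x xC i]; exact: xC.
- move=> u v t; rewrite !inE => uC vC i; rewrite /conv /= linearD !linearZ /=.
  by apply: addr_ge0; apply: mulr_ge0; rewrite ?unstable.onem_ge0 ?uC ?vC.
- exists [seq c i | i <- enum I]; apply/seteqP;
    split=> [v vC f /mapP[i _ ->]|v H i].
    exact: vC.
  by apply: H; rewrite map_f // mem_enum.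
Qed.

Lemma vinterior_cone : vinterior cone = open_cone.
Proof.
apply/seteqP; split=> v.
  (* Moving slightly against the sum of the [e j] lowers all coordinates equally without leaving the
     cone, so each was positive. *)
  move=> vC i; pose d := v2r (\sum_j e j).
  have lin : continuous (fun t : K => v2r v - t *: d).
    move=> t; apply: (@continuousB _ _ _ (fun=> v2r v) (fun t : K => t *: d)).
      exact: cst_continuous.
    exact: scalel_continuous.
  have /lin : nbhs (v2r v - 0 *: d) [set x | cone (r2v x)].
    by rewrite scale0r subr0.
  rewrite /= -/(nbhs _ _) => /nbhs_ballP[r /= r0 /(_ (r / 2))].
  have r2 : 0 < r / 2 by rewrite divr_gt0.
  rewrite /ball /= sub0r normrN gtr0_norm // => /(_ _)/(_ i).
  rewrite linearB linearZ /= !v2rK linearB linearZ linear_sum /=.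
  rewrite (bigD1 i) //= big1 => [|j ji];
    last by rewrite c_dual eq_sym (negPf ji).
  rewrite c_dual eqxx addr0 [_ *: _]mulr1 subr_ge0 => H.
  by apply: lt_le_trans (H _) => //; lra.
move=> vC; rewrite /vinterior /interior /=.
suff : \forall x \near v2r v, forall i, 0 < c i (r2v x).
  by apply: filterS => x xC i; exact: ltW.
apply: (@filter_forall _ _ _ (nbhs (v2r v))) => i.
apply: (@coord_continuous_rV i (v2r v) [set y | 0 < y]).
by apply: open_nbhs_nbhs; split; [exact: open_gt|rewrite /= v2rK].
Qed.

End SimplicialCone.

(** * Reflection groups and Vinberg systems *)

Section ReflectionGroup.
Variables (K : realType) (V : vectType K) (I : finType) (m : coxeter_matrix I).
Variables (c : I -> 'Hom(V, K^o)) (e : I -> V) (a : I -> I -> K).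
Variable act : coxeter_group m -> V -> V.
Hypothesis c_dual : forall i j, c i (e j) = (i == j)%:R.
Hypothesis c_expand : forall v, v = \sum_i c i v *: e i.
Hypothesis a_diag : forall s, a s s = 2.
Hypothesis a_fin : forall s t n, s != t -> m s t = Some n ->
  a s t = - (2 * cos (pi / n%:R)).
Hypothesis a_inf : forall s t, s != t -> m s t = None -> a s t <= - 2.
Hypothesis act_linear : forall w, linear (act w).
Hypothesis act1 : forall v, act 1%g v = v.
Hypothesis actM : forall w w' v, act (w * w')%g v = act w (act w' v).
Hypothesis act_gen : forall s v t,
  c t (act (cox_gen m s) v) = c t v - a s t * c s v.

Lemma fixed_points_gen s : fixed_points (act (cox_gen m s)) = coord_plane c s.
Proof.
apply/seteqP; split=> v /= vs.
  have := act_gen s v s; rewrite vs a_diag => cs.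
  by rewrite /coord_plane /=; lra.
apply: (coord_ext c_expand) => t; rewrite act_gen (vs : c s v = 0).
by rewrite mulr0 subr0.
Qed.

Lemma open_cone_neq0 : open_cone c !=set0.
Proof.
exists (\sum_i e i) => i; rewrite linear_sum (bigD1 i) //= big1 => [|j ji].
  by rewrite c_dual eqxx addr0; exact: ltr01.
by rewrite c_dual eq_sym (negPf ji).
Qed.

Lemma open_cone_disjoint w :
  (act w @` open_cone c) `&` open_cone c !=set0 <-> w = 1%g.
Proof.
split=> [|->].
  exact: (@chamber_disjoint _ _ _ _ (fun v i => c i v) a).
have [v vC] := open_cone_neq0; exists v; split=> //.
by exists v.
Qed.

(** Two elements acting alike differ by one that fixes a point of the open chamber, hence by the
    identity. *)
Lemma act_inj : injective act.
Proof.
move=> w w' ww'; apply: (mulgI w^-1%g); rewrite mulVg;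
  apply/esym/open_cone_disjoint.
have [v vC] := open_cone_neq0; exists v; split=> //; exists v => //.
by rewrite actM -ww' -actM mulVg.
Qed.

Lemma act_generated f :
  (exists w, act w = f) <-> generated_by (fun i => act (cox_gen m i)) f.
Proof.
split=> [[w <-]|].
  have [u _ <-] := cox_reduced w; elim: u => [|s u IHu].
    by rewrite (_ : act _ = id); [exact: generated_by_id|exact/funext].
  rewrite (_ : act _ = act (cox_gen m s) \o act (cox_word m u)).
    exact: generated_by_comp IHu.
  by apply/funext => v; rewrite cox_word_cons actM.
elim=> [|s _ _ [w <-]]; first by exists 1%g; exact/funext.
by exists (cox_gen m s * w)%g; apply/funext => v; exact: actM.
Qed.

Lemma gen_linear_reflection s : linear_reflection (act (cox_gen m s)).
Proof.
split; first exact: act_linear.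
  by move=> v; rewrite -actM cox_gen2 act1.
exists #|predC1 s|; first exact: (card_predC1S c_dual c_expand).
exists (lker (c s)); first exact: (dim_lker_coord c_dual c_expand).
rewrite fixed_points_gen; apply/seteqP; split=> v /=;
  rewrite /coord_plane /= memv_ker.
  by move=> ->.
by move/eqP.
Qed.

Lemma reflection_vinberg_system : vinberg_system (cox_gen m) act (open_cone c).
Proof.
have act_id : act 1%g = id by exact/funext.
split=> //; last exact: act_generated; last exact: act_inj; last first.
  by split=> // w w'; apply/funext => v; exact: actM.
exists (cone c); split.
- exact: cone_closed_convex_polyhedral.
- by rewrite (vinterior_cone c_dual); split; last exact: open_cone_neq0.
- exact: gen_linear_reflection.
- split=> [s t /=|X].
    rewrite !fixed_points_gen => st; apply: contrapT => /eqP nst.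
    (* The vector [e t] lies on every coordinate plane except its own, which separates the walls. *)
    have : coord_plane c s (e t) by rewrite /coord_plane /= c_dual (negPf nst).
    by rewrite st /coord_plane /= c_dual eqxx => /eqP; rewrite oner_eq0.
  rewrite (is_wall_cone c_dual c_expand).
  by split=> -[s ->]; exists s; rewrite fixed_points_gen.
- move=> f /act_generated[w <-]; rewrite open_cone_disjoint.
  by split=> [->//|]; rewrite -act_id => /act_inj.
Qed.

End ReflectionGroup.

(** * The two dual representations *)

(** By the triple angle formula the cosine is a positive root of 4c^3 - 3c + 1 = (c + 1)(2c -
    1)^2. *)
Lemma cos_pi_third (K : realType) : cos (pi / 3%:R) = 2^-1 :> K.
Proof.
set t := pi / 3%:R; have pi0 := pi_gt0 K.
have c0 : 0 < cos t by apply: cos_gt0_pihalf; apply/andP; split; rewrite /t;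
  lra.
have : cos (t + t + t) = -1 by rewrite -cospi; congr cos; rewrite /t; field.
rewrite cosD cosD sinD => c3.
have : (cos t + 1) * (2 * cos t - 1) ^+ 2 = 0.
  have := cos2Dsin2 t; nra.
move/eqP; rewrite mulf_eq0 gt_eqF ?ltr_wpDr // sqrf_eq0 => /eqP h.
by lra.
Qed.

Section DualBases.
Variables (K : realType) (S : finType) (m : coxeter_matrix S).
Variables (R : nzRingType) (B : finType) (F : fusion_ring R B).
Local Notation HomZ := (HomZ K S F).
Local Notation HomR := (HomR K S F).

(** * Dual coordinates on [HomZ] *)

Definition HomZ_eval (x : B * S) (Z : HomZ) : K^o := Z (F x.1 *: alpha x.2).

Lemma HomZ_eval_linear x : linear (HomZ_eval x).
Proof. by []. Qed.
HB.instance Definition _ x :=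
  GRing.isLinear.Build K HomZ K^o *:%R (HomZ_eval x) (HomZ_eval_linear x).

Definition HomZ_coord x : 'Hom(HomZ, K^o) := linfun (HomZ_eval x).

Lemma HomZ_coordE x Z : HomZ_coord x Z = Z (F x.1 *: alpha x.2).
Proof. exact: lfunE. Qed.

Fact HomZ_dual_subproof (x : B * S) :
  @is_HomZ K S R (fun v => (fr_coord F (v x.2) x.1)%:~R).
Proof. by apply/asboolP => u v; rewrite ffunE fr_coordD rmorphD. Qed.

Definition HomZ_dual x : HomZ := MkHomZ F (HomZ_dual_subproof x).

Lemma HomZ_coord_dual x y : HomZ_coord x (HomZ_dual y) = (x == y)%:R.
Proof.
rewrite HomZ_coordE /= !ffunE; case: x y => [b s] [b' s'] /=.
rewrite xpair_eqE (eq_sym s'); case: (eqVneq s s') => _ /=.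
  by rewrite [_ *: _]mulr1 fr_coord_basis andbT eq_sym; case: eqP.
by rewrite [_ *: _]mulr0 fr_coord0 andbF.
Qed.

Lemma HomZ_ext (Z Z' : HomZ) : (forall x, HomZ_coord x Z = HomZ_coord x Z') ->
  Z = Z'.
Proof.
move=> ZZ'; apply/val_inj/funext; apply: (@Lambda_ext S R B F) => [||b s].
- exact: HomZ_add.
- exact: HomZ_add.
- by have := ZZ' (b, s); rewrite !HomZ_coordE.
Qed.

Lemma HomZ_expand Z : Z = \sum_x HomZ_coord x Z *: HomZ_dual x.
Proof.
apply: HomZ_ext => y; rewrite linear_sum (bigD1 y) //= big1 => [|x xy];
  rewrite linearZ /= HomZ_coord_dual.
  by rewrite eqxx addr0 [_ *: _]mulr1.
by rewrite eq_sym (negPf xy) [_ *: _]mulr0.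
Qed.

(** * Dual coordinates on [HomR] *)

Definition HomR_eval (s : S) (Z : HomR) : K^o := Z (alpha s).

Lemma HomR_eval_linear s : linear (HomR_eval s).
Proof. by []. Qed.
HB.instance Definition _ s :=
  GRing.isLinear.Build K HomR K^o *:%R (HomR_eval s) (HomR_eval_linear s).

Definition HomR_coord s : 'Hom(HomR, K^o) := linfun (HomR_eval s).

Lemma HomR_coordE s Z : HomR_coord s Z = Z (alpha s).
Proof. exact: lfunE. Qed.

(** Here [R]-linearity is exactly the multiplicativity of [FPdim]. *)
Fact HomR_dual_subproof (s : S) : @is_HomR K S R B F (fun v => FPdim F K (v s)).
Proof.
apply/asboolP; split=> [u v|x v]; rewrite ffunE; first exact: FPdimD.
exact: FPdimM.
Qed.

Definition HomR_dual s : HomR := MkHomR (HomR_dual_subproof s).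

Lemma FPdim0 : FPdim F K 0 = 0.
Proof. by rewrite /FPdim big1 // => i _; rewrite fr_coord0 mul0r. Qed.

Lemma HomR_coord_dual s t : HomR_coord s (HomR_dual t) = (s == t)%:R.
Proof.
rewrite HomR_coordE /= ffunE eq_sym; case: eqP => _; first exact: FPdim1.
exact: FPdim0.
Qed.

Lemma HomR_ext (Z Z' : HomR) : (forall s, HomR_coord s Z = HomR_coord s Z') ->
  Z = Z'.
Proof.
move=> ZZ'; apply/val_inj/funext; apply: (@Lambda_ext S R B F) => [||b s].
- exact: HomR_add.
- exact: HomR_add.
- by rewrite /= !HomR_scale -!HomR_coordE ZZ'.
Qed.

Lemma HomR_expand Z : Z = \sum_s HomR_coord s Z *: HomR_dual s.
Proof.
apply: HomR_ext => y; rewrite linear_sum (bigD1 y) //= big1 => [|x xy];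
  rewrite linearZ /= HomR_coord_dual.
  by rewrite eqxx addr0 [_ *: _]mulr1.
by rewrite eq_sym (negPf xy) [_ *: _]mulr0.
Qed.

(** * The two actions in coordinates *)

Variable G : geometric_realisation K m F.

Lemma HomZ_act_linear w : linear (HomZ_act (G := G) w).
Proof. by move=> t Z Z'; apply/val_inj. Qed.

Lemma HomZ_act1 Z : HomZ_act (1%g : unf_group G) Z = Z.
Proof. by apply/val_inj/funext => v /=; rewrite invg1 unf_act1. Qed.

Lemma HomZ_actM (w w' : unf_group G) Z :
  HomZ_act (w * w')%g Z = HomZ_act w (HomZ_act w' Z).
Proof. by apply/val_inj/funext => v /=; rewrite invgM unf_actM. Qed.

Lemma fold_unf_alpha (x : B * S) :
  fold_Lambda F (unf_alpha x) = F x.1 *: alpha x.2.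
Proof.
rewrite -[RHS](unfold_LambdaK F); congr fold_Lambda; apply/ffunP => -[b s].
rewrite !ffunE; case: x => [b' s'] /=; rewrite xpair_eqE;
  case: (eqVneq s s') => _ /=.
  by rewrite [_ *: _]mulr1 fr_coord_basis andbT.
by rewrite [_ *: _]mulr0 fr_coord0 andbF.
Qed.

(** A generator is its own inverse, so the new coordinate is the value of [Z] on the reflected basis
    vector. *)
Lemma HomZ_act_gen x Z y :
  HomZ_coord y (HomZ_act (cox_gen (unf_matrix G) x) Z) =
  HomZ_coord y Z - (unf_r G x y)%:~R * HomZ_coord x Z.
Proof.
rewrite !HomZ_coordE /= cox_genV /unf_act -fold_unf_alpha fold_LambdaK.
rewrite ZLambda_act_gen /unf_refl -[X in unf_form _ _ X]mulr1z unf_form_alphaZ.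
rewrite mulr1.
rewrite -[in RHS]fold_unf_alpha.
have hB : zmod_morphism (fun v => Z (fold_Lambda F v)).
  pose h v : K := Z (fold_Lambda F v).
  have hD u v : h (u + v) = h u + h v by rewrite /h fold_LambdaD HomZ_add.
  by move=> u v; apply/eqP; rewrite eq_sym subr_eq -[_ + _]hD subrK.
pose h : {additive ZLambda B S -> K^o} :=
  HB.pack (fun v => Z (fold_Lambda F v)) (GRing.isZmodMorphism.Build _ _ _ hB).
rewrite -[LHS]/(h _) raddfB raddfMz /h /= -mulrzr mulrC.
by [].
Qed.

(** Off the zero case, this is minus a coordinate of a product of two non-negative elements. *)
Lemma unf_r_le0 x y : x != y -> unf_r G x y <= 0.
Proof.
rewrite /unf_r => /negPf ->; case: ifP => // /negbT st.
rewrite -oppr_ge0 -fr_coordN -mulrN.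
apply: fr_nneg_mul; last exact: gr_form_nneg.
by move=> i; rewrite fr_coord_basis ler0n.
Qed.

Lemma HomR_act_linear w : linear (HomR_act G w).
Proof. by move=> t Z Z'; apply/val_inj. Qed.

Lemma HomR_act1 Z : HomR_act G 1%g Z = Z.
Proof. by apply/val_inj/funext => v /=; rewrite invg1 gr_act1. Qed.

Lemma HomR_actM w w' Z :
  HomR_act G (w * w')%g Z = HomR_act G w (HomR_act G w' Z).
Proof. by apply/val_inj/funext => v /=; rewrite invgM gr_actM. Qed.

Lemma HomR_act_gen s Z t : HomR_coord t (HomR_act G (cox_gen m s) Z) =
  HomR_coord t Z - FPdim F K (gr_form G (alpha s) (alpha t)) * HomR_coord s Z.
Proof.
rewrite !HomR_coordE /= cox_genV gr_act_gen -scaleNr HomR_add HomR_scale.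
rewrite -mulNr; congr (_ + _ * _); apply/eqP.
by rewrite -addr_eq0 -FPdimD addNr FPdim0.
Qed.

Lemma unf_coef_diag x : (unf_r G x x)%:~R = 2 :> K.
Proof. by rewrite /unf_r eqxx. Qed.

(** The labels 2 and 3 stand for the entries 0 and -1, and cos(pi/2) = 0, cos(pi/3) = 1/2. *)
Lemma unf_coef_fin x y n : x != y -> unf_matrix G x y = Some n ->
  (unf_r G x y)%:~R = - (2 * cos (pi / n%:R)) :> K.
Proof.
move=> /negPf xy /=; rewrite /unf_label xy.
case: eqP => [-> [<-]|_]; first by rewrite cos_pihalf mulr0 oppr0.
case: eqP => [-> [<-]|//]; rewrite cos_pi_third mulfV ?pnatr_eq0 //.
Qed.

(** Integrality: a non-positive integer other than 0 and -1 is at most -2. *)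
Lemma unf_coef_inf x y : x != y -> unf_matrix G x y = None ->
  (unf_r G x y)%:~R <= - 2 :> K.
Proof.
move=> xy /=; rewrite /unf_label (negPf xy); have := unf_r_le0 xy.
case: eqP => [//|/eqP r0]; case: eqP => [//|/eqP r1] r_le0 _.
have -> : - 2 = (- 2 : int)%:~R :> K by rewrite rmorphN.
by rewrite ler_int; lia.
Qed.

Lemma FP_coef_diag s : FPdim F K (gr_form G (alpha s) (alpha s)) = 2.
Proof. by rewrite gr_form_diag FPdimD FPdim1. Qed.

End DualBases.

Theorem proposition4p12 (K : realType) (S : finType) (m : coxeter_matrix S)
    (R : nzRingType) (B : finType) (F : fusion_ring R B)
    (G : geometric_realisation K m F) :
  let Cv : set (HomZ K S F) := [set Z | forall b s, 0 <= Z (F b *: alpha s)] in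
  let Cv_o : set (HomZ K S F) := [set Z | forall b s, 0 < Z (F b *: alpha s)] in
  let Hv (x : B * S) : set (HomZ K S F) :=
    [set Z | Z (F x.1 *: alpha x.2) = 0] in
  let C : set (HomR K S F) := [set Z | forall s, 0 <= Z (alpha s)] in
  let C_o : set (HomR K S F) := [set Z | forall s, 0 < Z (alpha s)] in
  let H (s : S) : set (HomR K S F) := [set Z | Z (alpha s) = 0] in
  [/\ [/\ closed_convex_polyhedral_cone Cv, vinterior Cv = Cv_o,
          closed_convex_polyhedral_cone C & vinterior C = C_o],
      (forall X, is_wall Cv X <-> exists x, X = Hv x) /\
      (forall X, is_wall C X <-> exists s, X = H s),
      (forall x, fixed_points (HomZ_act (cox_gen (unf_matrix G) x)) = Hv x) /\
      (forall s, fixed_points (HomR_act G (cox_gen m s)) = H s),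
      (forall w : unf_group G,
         (HomZ_act w @` Cv_o) `&` Cv_o !=set0 <-> w = 1%g) /\
      (forall w : coxeter_group m,
         (HomR_act G w @` C_o) `&` C_o !=set0 <-> w = 1%g) &
      vinberg_system (cox_gen (unf_matrix G)) (@HomZ_act K S m R B F G) Cv_o /\
      vinberg_system (cox_gen m) (HomR_act G) C_o].
Proof.
move=> Cv Cv_o Hv C C_o H.
(* Rewritten in dual coordinates, both halves become instances of the results on simplicial cones
   and reflection groups. *)
have CvE : Cv = cone (@HomZ_coord K S R B F).
  apply/seteqP; split=> Z ZC; first by move=> x; rewrite HomZ_coordE; exact: ZC.
  by move=> b s; have := ZC (b, s); rewrite HomZ_coordE.
have CvoE : Cv_o = open_cone (@HomZ_coord K S R B F).
  apply/seteqP; split=> Z ZC; first by move=> x; rewrite HomZ_coordE; exact: ZC.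
  by move=> b s; have := ZC (b, s); rewrite HomZ_coordE.
have HvE : Hv = coord_plane (@HomZ_coord K S R B F).
  by apply/funext => x; apply/seteqP; split=> Z;
    rewrite /coord_plane /= HomZ_coordE.
have CE : C = cone (@HomR_coord K S R B F).
  by apply/seteqP; split=> Z ZC s; have := ZC s; rewrite HomR_coordE.
have CoE : C_o = open_cone (@HomR_coord K S R B F).
  by apply/seteqP; split=> Z ZC s; have := ZC s; rewrite HomR_coordE.
have HE : H = coord_plane (@HomR_coord K S R B F).
  by apply/funext => s; apply/seteqP; split=> Z;
    rewrite /coord_plane /= HomR_coordE.
have dZ := @HomZ_coord_dual K S R B F; have dR := @HomR_coord_dual K S R B F.
have xZ := @HomZ_expand K S R B F; have xR := @HomR_expand K S R B F.
have aZ := unf_coef_diag G; have aR := FP_coef_diag G.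
have finZ := @unf_coef_fin K S m R B F G; have finR := gr_form_fin G.
have infZ := @unf_coef_inf K S m R B F G; have infR := gr_form_inf G.
have linZ := @HomZ_act_linear K S m R B F G.
have linR := @HomR_act_linear K S m R B F G.
have oneZ := @HomZ_act1 K S m R B F G; have oneR := @HomR_act1 K S m R B F G.
have mulZ := @HomZ_actM K S m R B F G; have mulR := @HomR_actM K S m R B F G.
have genZ := @HomZ_act_gen K S m R B F G.
have genR := @HomR_act_gen K S m R B F G.
rewrite CvE CvoE HvE CE CoE HE; split.
- by split; [exact: cone_closed_convex_polyhedral|exact: vinterior_cone dZ
            |exact: cone_closed_convex_polyhedral|exact: vinterior_cone dR].
- by split=> X; [exact: is_wall_cone dZ xZ X|exact: is_wall_cone dR xR X].
- split=> x; first exact: (fixed_points_gen xZ aZ genZ).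
  exact: (fixed_points_gen xR aR genR).
- split.
    exact: (open_cone_disjoint dZ aZ finZ infZ oneZ mulZ genZ).
  exact: (open_cone_disjoint dR aR finR infR oneR mulR genR).
- split.
    exact: (reflection_vinberg_system dZ xZ aZ finZ infZ linZ oneZ mulZ genZ).
  exact: (reflection_vinberg_system dR xR aR finR infR linR oneR mulR genR).
Qed.
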